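(* Let $k\in\mathbb{N}$, let $\mathcal{D}:\mathbb{R}_{>0}\times\mathbb{N}\to\mathbb{R}_{>0}$ be an arbitrary function, and let $\eta>0$. Let $Z$ be a finite abelian group and let $f:Z\to\mathbb{C}$ be a 1-bounded function. Let $f=\sum_{\chi\in S}g_\chi+g_e+f_e+f_r$, with complexity bound $m\le N(\eta,\mathcal{D})$, be an $(\eta,\mathcal{D})$-regularity decomposition of $f$ of order $k$ (as defined in the context). Then $$\|f\|_{U^{k+1}}^{2^{k+1}}=\sum_{\chi\in S}\|g_\chi\|_{U^{k+1}}^{2^{k+1}}+\mathcal{E},$$ where $|\mathcal{E}|\le2^{2^{k+1}}\big(4\eta^{\frac{k+2}{2^{k+1}}}+\mathcal{D}(\eta,m)\big)+(|S|^{2^{k+1}}-1)\,\mathcal{D}(\eta,m)^{1/2^k}$.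
   Context: Finite groups. $Z$ is a finite abelian group; $\langle f,g\rangle=\mathbb{E}_{x\in Z}f(x)\overline{g(x)}$, $\|f\|_p=(\mathbb{E}_x|f(x)|^p)^{1/p}$; 1-bounded means $|f|\le1$. $\|f\|_{U^k}=\big(\mathbb{E}_{x,t_1,\dots,t_k}\prod_{v\in\{0,1\}^k}\mathcal{C}^{|v|}f(x+v_1t_1+\cdots+v_kt_k)\big)^{1/2^k}$, with $\mathcal{C}$ complex conjugation and $|v|=\sum v_i$. For $f,g:Z\to\mathbb{C}$, $\langle f,g\rangle_{U^k}=\mathbb{E}_{x,t_1,\dots,t_k}\prod_{v\in\{0,1\}^k}\mathcal{C}^{|v|}f_v(x+v_1t_1+\cdots+v_kt_k)$ with $f_v=f$ if $v_k=0$ and $f_v=g$ if $v_k=1$. Regularity decomposition. An $(\eta,\mathcal{D})$-regularity decomposition of order $k$ of a 1-bounded $f$, with complexity bound $m$, consists of a $k$-step cfr nilspace $Y$ of complexity at most $m$, a $\mathcal{D}(\eta,m)$-balanced morphism $\phi:Z\to Y$, a 1-bounded $m$-Lipschitz $F:Y\to\mathbb{C}$, and $f=f_s+f_e+f_r$ with $f_s=F\circ\phi$, $\|f_e\|_1\le\eta$, $\|f_r\|_\infty\le1$, $\max(\|f_r\|_{U^{k+1}},|\langle f_r,f_s\rangle|,|\langle f_r,f_e\rangle|)\le\mathcal{D}(\eta,m)$, together with $S\subset\widehat{Z_k(Y)}$, $|S|\le Q(\eta,m)$, such that with $g_\chi=F_\chi\circ\phi$ we have $f_s=\sum_{\chi\in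 S}g_\chi+g_e$, $\|g_e\|_\infty\le\eta$, and $\max(|\langle g_\chi,g_{\chi'}\rangle|,\langle g_\chi,g_{\chi'}\rangle_{U^{k+1}})\le\mathcal{D}(\eta,m)$ for $\chi\ne\chi'$ in $S$. The paper's regularity theorem says that for every $\eta,\mathcal{D}$ there is $N(\eta,\mathcal{D})$ such that every 1-bounded $f$ on every finite abelian group has such a decomposition for some $m\in[1,N(\eta,\mathcal{D})]$. Nilspaces. A cube morphism $\{0,1\}^m\to\{0,1\}^n$ is the restriction of an affine homomorphism $\mathbb{Z}^m\to\mathbb{Z}^n$. A nilspace is a set $X$ with sets $C^n(X)\subset X^{\{0,1\}^n}$, $n\ge0$ ($n$-cubes), such that: $c\circ\psi\in C^m(X)$ for every $c\in C^n(X)$ and cube morphism $\psi:\{0,1\}^m\to\{0,1\}^n$; $C^1(X)=X^{\{0,1\}}$; and any $c':\{0,1\}^n\setminus\{1^n\}\to X$ whose restriction to each face $\{v:v_i=0\}$ is an $(n-1)$-cube extends to an $n$-cube. It is $k$-step if this extension is unique for $n=k+1$. A morphism is a map sending cubes to cubes by composition. For an abelian group $A$, $\mathcal{D}_j(A)$ is the nilspace on $A$ whose $n$-cubes are the maps $c:\{0,1\}^n\to A$ with $\sum_{v\in\{0,1\}^{j+1}}(-1)^{|v|}c(\psi(v))=0$ for all cube morphisms $\psi:\{0,1\}^{j+1}\to\{0,1\}^n$. A finite abelian group $Z$ is viewed as $\mathcal{D}_1(Z)$, whose $n$-cubes are the maps $v\mapsto x+v_1t_1+\cdots+v_nt_n$.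 A compact nilspace is a nilspace with a compact Hausdorff second-countable topology with every $C^n(X)$ closed. Structure groups. For a $k$-step compact nilspace $X$ let $x\sim_jy$ iff there are $c,c'\in C^{j+1}(X)$ with $c(0)=x$, $c'(0)=y$ and $c=c'$ elsewhere; $X_j=X/\sim_j$ ($X_k=X$, $X_0$ a point). There are compact abelian groups $Z_j(X)$ (structure groups), $1\le j\le k$, with $Z_j(X)$ acting freely and continuously on $X_j$, orbits being the fibres of $X_j\to X_{j-1}$, and such that for $c\in C^n(X_j)$ the cubes in $C^n(X_j)$ with the same image in $X_{j-1}$ as $c$ are exactly $c+d$, $d\in C^n(\mathcal{D}_j(Z_j(X)))$. The action of $z\in Z_k(X)$ on $x\in X$ is $x+z$. $X$ is a cfr (compact finite-rank) nilspace if all $Z_j(X)$ are Lie groups. The Haar measure $\mu_{C^n(X)}$ is the unique Borel probability measure on $C^n(X)$ defined recursively by being invariant under addition of elements of $C^n(\mathcal{D}_k(Z_k(X)))$ and projecting to $\mu_{C^n(X_{k-1})}$; for $Z$ finite, $\mu_{C^n(Z)}$ is uniform. For bounded Borel $F:X\to\mathbb{C}$ and $\chi\in\widehat{Z_k(X)}$, $F_\chi(x)=\int_{Z_k(X)}F(x+z)\overline{\chi(z)}\,d\mu(z)$ ($\mu$ probability Haar measure). Fixed choices. An enumeration $Y_1,Y_2,\dots$ of the isomorphism classes of cfr nilspaces is fixed; $Y_i$ has complexity $i$. A $k$-step cfr nilspace is isomorphic to a quotient $F/H$ of a free nilspace $F=\prod_{i=1}^k\mathcal{D}_i(\mathbb{Z}^{a_i}\times\mathbb{R}^{b_i})$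 by a $k$-th order lattice action $H$, and is a smooth compact manifold with the structure making $F\to F/H$ a submersion; each $Y_i$ carries a fixed Riemannian metric tensor invariant under its last structure group, with $d(x,y)$ the geodesic distance within connected components and 1 across components; Lipschitz constants are with respect to $d$. For each $Y_i$ and $n$ a metric $d_n$ generating the weak topology on Borel probability measures on $C^n(Y_i)$ is fixed; $\phi:Z\to Y_i$ is $b$-balanced if $d_n\big(\mu_{C^n(Z)}\circ(\phi^{\{0,1\}^n})^{-1},\mu_{C^n(Y_i)}\big)\le b$ for every $n\le1/b$. For each $Y_i$, with last structure group $Z_k$, fix $Q_{Y_i}:\mathbb{R}_{>0}\times\mathbb{R}_{\ge0}\to\mathbb{N}$ such that for all $C,\delta>0$ there is $S\subset\widehat{Z_k}$ with $|S|\le Q_{Y_i}(\delta,C)$ and $\|F-\sum_{\chi\in S}F_\chi\|_\infty\le\delta$ for every $C$-Lipschitz $F:Y_i\to\mathbb{C}$. Put $Q(\eta,m)=\max_{i\le m}Q_{Y_i}(\eta,m)$.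
   Formalization: When S is empty the factor |S|^{2^{k+1}}−1 is read as 0 instead of −1, since the literal bound can then be negative (e.g. f=0, one-point nilspace, k=1, D=10^{-4}, η=10^{-12}); for nonempty S the bound is as stated. *)

(* Defs.v *)
From HB Require Import structures.
From mathcomp Require Import all_boot all_order all_algebra finmap.
From mathcomp Require Import generic_quotient complex.
From mathcomp Require Import all_classical all_reals all_analysis.

Set Implicit Arguments.
Unset Strict Implicit.
Unset Printing Implicit Defensive.
Import Order.TTheory GRing.Theory Num.Theory numFieldNormedType.Exports.
Local Open Scope classical_set_scope.
Local Open Scope ring_scope.

Definition dcube (n : nat) : Type := {ffun 'I_n -> bool}.
HB.instance Definition _ n := Finite.on (dcube n).

Definition weight n (v : dcube n) : nat := (\sum_(i < n) v i)%N.
Definition cube0 n : dcube n := [ffun => false].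
Definition cube1 n : dcube n := [ffun => true].

Definition cube_vec n (v : dcube n) : 'rV[int]_n := \row_i (v i : nat)%:Z.

Definition cube_morphism m n (psi : dcube m -> dcube n) : Prop :=
  exists (b : 'rV[int]_n) (M : 'M[int]_(m, n)),
    forall v, cube_vec (psi v) = b + cube_vec v *m M.

(* The parametrisation of the face [v_i = 0] of {0,1}^(n+1) by {0,1}^n. *)
Definition lower_face n (i : 'I_n.+1) (w : dcube n) : dcube n.+1 :=
  [ffun j => if unlift i j is Some l then w l else false].

Section Gowers.
Variables (R : realType) (Z : finZmodType).
Implicit Types f g : Z -> R[i].

Definition cmod (z : R[i]) : R := complex.Re `|z|.

Definition bounded1 (T : Type) (f : T -> R[i]) : Prop :=
  forall x, cmod (f x) <= 1.

Definition inner f g : R[i] := (\sum_x f x * (g x)^*) / #|Z|%:R.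

Definition norm1 f : R := (\sum_x cmod (f x)) / #|Z|%:R.
Definition norm_sup f : R := \big[Num.max/0]_x cmod (f x).

(* E_(x, t_1, ..., t_k) prod_v C^|v| f_v (x + v_1 t_1 + ... + v_k t_k) *)
Definition gowers_avg k (F : dcube k -> Z -> R[i]) : R[i] :=
  (\sum_(x : Z) \sum_(t : {ffun 'I_k -> Z}) \prod_(v : dcube k)
     iter (weight v) Num.conj (F v (x + \sum_(i < k) t i *+ v i)))
  / (#|Z| ^ k.+1)%N%:R.

(* For k >= 1 the average is a nonnegative real number, so that taking the
   real part loses nothing. *)
Definition gowers_norm k f : R :=
  complex.Re (gowers_avg (fun _ : dcube k => f)) `^ (1 / (2 ^ k)%N%:R).

(* <f, g>_(U^(k+1)); the last coordinate of v selects f or g. *)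
Definition gowers_inner k f g : R[i] :=
  gowers_avg (fun v : dcube k.+1 => if v ord_max then g else f).

End Gowers.

Section Cubes.
Variables (T : Type) (C : forall n, set (dcube n -> T)).

(* A corner is given by a total map whose value at 1^n is irrelevant. *)
Definition is_nilspace : Prop :=
  [/\ forall m n (c : dcube n -> T) (psi : dcube m -> dcube n),
        C c -> cube_morphism psi -> C (c \o psi),
      forall c : dcube 1 -> T, C c
    & forall n (c' : dcube n.+1 -> T),
        (forall i, C (c' \o lower_face i)) ->
        exists2 c, C c & forall v, v <> cube1 n.+1 -> c v = c' v].

Definition is_step (k : nat) : Prop :=
  forall c c' : dcube k.+1 -> T, C c -> C c' ->
    (forall v, v <> cube1 k.+1 -> c v = c' v) -> c = c'.

Definition sim (j : nat) (x y : T) : Prop :=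
  exists c c' : dcube j.+1 -> T,
    [/\ C c, C c', c (cube0 _) = x, c' (cube0 _) = y
      & forall v, v <> cube0 _ -> c v = c' v].

(* Translations of height i: applying alpha on a face of codimension i (where
   the coordinates in J are fixed to those of e) preserves cubes. *)
Definition translation (i : nat) (alpha : T -> T) : Prop :=
  forall n (c : dcube n -> T) (J : {set 'I_n}) (e : dcube n),
    #|J| = i -> C c ->
    C (fun v => if [forall l in J, v l == e l] then alpha (c v) else c v).

End Cubes.

Definition nil_morphism (T T' : Type) (C : forall n, set (dcube n -> T))
    (C' : forall n, set (dcube n -> T')) (f : T -> T') : Prop :=
  forall n (c : dcube n -> T), C n c -> C' n (f \o c).

(* The cubes of D_j(A). *)
Definition Dcube (j : nat) (A : zmodType) (n : nat) : set (dcube n -> A) :=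
  [set c | forall psi : dcube j.+1 -> dcube n, cube_morphism psi ->
     \sum_(v : dcube j.+1) c (psi v) *~ (-1) ^+ weight v = 0].

HB.instance Definition _ (U : Type) (T : U -> ptopologicalType) :=
  Pointed.copy (prod_topology T) (forall x : U, T x).

(* A space with cubes. The base point only records that it is nonempty. *)
Record cubespace := Cubespace {
  cs_sort :> ptopologicalType;
  cs_cubes : forall n, set {ptws dcube n -> cs_sort}
}.
Arguments cs_cubes : clear implicits.

Definition compact_nilspace (X : cubespace) : Prop :=
  [/\ is_nilspace (cs_cubes X), compact [set: X], hausdorff_space X,
      @second_countable X & forall n, closed (cs_cubes X n)].

Definition nil_iso (X Y : cubespace) : Prop :=
  exists (f : X -> Y) (g : Y -> X),
    [/\ cancel f g, cancel g f, continuous f, continuous g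
      & nil_morphism (cs_cubes X) (cs_cubes Y) f /\
        nil_morphism (cs_cubes Y) (cs_cubes X) g].

Section Factor.
Variables (j : nat) (X : cubespace).

(* Comparing classes makes this an equivalence relation without any
   hypothesis on X; it is ~_j whenever ~_j is an equivalence, in particular on
   every nilspace. *)
Definition sim_class (x : X) : set X := sim (cs_cubes X) j x.
Definition sim_rel (x y : X) : bool := `[< sim_class x = sim_class y >].

Lemma sim_rel_refl : reflexive sim_rel.
Proof. by move=> x; apply/asboolP. Qed.
Lemma sim_rel_sym : symmetric sim_rel.
Proof. by move=> x y; apply/asboolP/asboolP => ->. Qed.
Lemma sim_rel_trans : transitive sim_rel.
Proof. by move=> y x z /asboolP xy /asboolP yz; apply/asboolP; rewrite xy. Qed.

Canonical sim_equiv := EquivRel sim_rel sim_rel_refl sim_rel_sym sim_rel_trans.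

Definition nil_factor_sort : ptopologicalType :=
  quotient_topology {eq_quot sim_equiv}%qT.

Definition nil_pi (x : X) : nil_factor_sort :=
  (\pi_{eq_quot sim_equiv} x)%qT.

Definition nil_factor : cubespace :=
  @Cubespace nil_factor_sort
    (fun n => [set c | exists2 b, cs_cubes X n b & c = nil_pi \o b]).

End Factor.

(* A topological abelian group, pointed by 0. *)
Definition pointed_group (A : topologicalZmodType) : Type := A.
HB.instance Definition _ (A : topologicalZmodType) :=
  Topological.copy (pointed_group A) A.
HB.instance Definition _ (A : topologicalZmodType) :=
  isPointed.Build (pointed_group A) (0 : A).

(* A, acting through [act], is the j-th structure group of the j-step nilspace
   X. The classes of ~_(j-1) on X are the fibres of X -> X_(j-1). *)
Definition is_structure_group (j : nat) (X : cubespace)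
    (A : topologicalZmodType) (act : X -> A -> X) : Prop :=
  [/\ compact [set: A] /\ hausdorff_space A,
      [/\ forall x, act x 0 = x,
          forall x a b, act (act x a) b = act x (a + b),
          forall x a, act x a = x -> a = 0
        & continuous (fun p : X * A => act p.1 p.2)],
      forall x y, sim (cs_cubes X) j.-1 x y <-> exists a, y = act x a
    & forall n (c c' : dcube n -> X), cs_cubes X n c ->
        ((cs_cubes X n c' /\ forall v, sim (cs_cubes X) j.-1 (c v) (c' v)) <->
         exists2 d, Dcube j d & c' = fun v => act (c v) (d v))].

Section Smooth.
Variable R : realType.

(* C^r on an open subset U of a finite-dimensional space. *)
Fixpoint Cr_on (V W : normedModType R) (r : nat) (U : set V) (f : V -> W)
    : Prop :=
  match r with
  | 0 => forall x, U x -> {for x, continuous f}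
  | s.+1 => (forall x, U x -> differentiable f x) /\
            forall v : V, Cr_on s U (fun x => 'D_v f x)
  end.

Definition smooth_on (V W : normedModType R) (U : set V) (f : V -> W) : Prop :=
  forall r, Cr_on r U f.

(* [fwd] is only meaningful on [dom], and [inv] on the image of [dom]. *)
Record chart (M : topologicalType) (n : nat) := Chart {
  dom : set M;
  fwd : M -> 'rV[R]_n;
  inv : 'rV[R]_n -> M
}.

Definition img M n (c : @chart M n) : set 'rV[R]_n := fwd c @` dom c.

Definition smooth_atlas M n (At : set (@chart M n)) : Prop :=
  [/\ forall c, At c ->
        [/\ open (dom c), open (img c), forall x, dom c x -> inv c (fwd c x) = x,
            {within dom c, continuous (fwd c)}
          & {within img c, continuous (inv c)}],
      forall x, exists2 c, At c & dom c x
    & forall c c', At c -> At c' ->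
        smooth_on (fwd c @` (dom c `&` dom c')) (fwd c' \o inv c)].

Definition is_lie (A : topologicalZmodType) : Prop :=
  exists n (At : set (@chart A n)),
    [/\ smooth_atlas At,
        forall c c', At c -> At c' ->
          smooth_on [set u | img c u /\ dom c' (- inv c u)]
            (fun u => fwd c' (- inv c u))
      & forall c1 c2 c, At c1 -> At c2 -> At c ->
          smooth_on
            [set u : 'rV[R]_n * 'rV[R]_n |
               [/\ img c1 u.1, img c2 u.2 & dom c (inv c1 u.1 + inv c2 u.2)]]
            (fun u => fwd c (inv c1 u.1 + inv c2 u.2))].

Section Riemann.
Variables (M : topologicalType) (n : nat) (At : set (@chart M n)).

(* A metric tensor is given by its Gram matrix in each chart of the atlas. *)
Variable G : @chart M n -> 'rV[R]_n -> 'M[R]_n.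

Definition tensor_sq c (u v : 'rV[R]_n) : R := (v *m G c u *m v^T) 0 0.

Definition tensor_preserved (T : M -> M) : Prop :=
  forall c c' y, At c -> At c' -> dom c y -> dom c' (T y) ->
  forall v : 'rV[R]_n,
    tensor_sq c (fwd c y) v =
    tensor_sq c' (fwd c' (T y)) ('D_v (fwd c' \o T \o inv c) (fwd c y)).

(* The last clause is the compatibility of the Gram matrices between charts. *)
Definition riemannian : Prop :=
  [/\ forall c, At c -> smooth_on (img c) (G c),
      forall c u, At c -> img c u ->
        (G c u)^T = G c u /\ forall v, v != 0 -> 0 < tensor_sq c u v
    & tensor_preserved id].

(* l is the length of a piecewise C^1 path from x to y, cut into pieces each of
   which lies in the domain of one chart. *)
Inductive path_length : M -> M -> R -> Prop :=
| PathNil x : path_length x x 0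
| PathCons c (s : R -> 'rV[R]_n) y l :
    At c -> (forall t, derivable s t 1) -> continuous (derive1 s) ->
    (forall t, 0 <= t <= 1 -> img c (s t)) ->
    path_length (inv c (s 1)) y l ->
    path_length (inv c (s 0)) y
      (\int[lebesgue_measure]_(t in `[0, 1])
         Num.sqrt (tensor_sq c (s t) (derive1 s t)) + l).

Definition geodesic_dist (x y : M) : R :=
  if `[< connected_component [set: M] x y >]
  then inf [set l | path_length x y l] else 1.

End Riemann.

Section Free.
Variables (k : nat) (a b : 'I_k -> nat).

(* The free nilspace prod_(1 <= i <= k) D_i(Z^(a_i) x R^(b_i)); the level i is
   indexed by i - 1 : 'I_k. *)
Definition free_nil : Type := forall i : 'I_k, ('rV[int]_(a i) * 'rV[R]_(b i))%type.

Definition free_cubes (n : nat) : set (dcube n -> free_nil) :=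
  [set c | forall i : 'I_k, Dcube i.+1 (fun v => c v i)].

(* As a manifold, the free nilspace is a disjoint union of copies of
   R^(b_1 + ... + b_k), parametrised by their integer coordinates z. *)
Definition free_sheet (z : forall i, 'rV[int]_(a i)) (x : 'rV[R]_(\sum_i b i))
    : free_nil := fun i => (z i, submxrow x i).

Definition free_continuous (h : free_nil -> free_nil) : Prop :=
  forall z i,
    (forall x x', (h (free_sheet z x) i).1 = (h (free_sheet z x') i).1) /\
    continuous (fun x => (h (free_sheet z x) i).2).

(* The shifts of the level i by the elements of H of height i. *)
Definition level_shifts (H : set (free_nil -> free_nil)) (i : 'I_k) :
    set ('rV[int]_(a i) * 'rV[R]_(b i))%type :=
  [set h (fun=> 0) i | h in H `&` translation free_cubes i.+1].
Arguments level_shifts : clear implicits.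

(* A group of translations of the free nilspace which is fibre-transitive,
   fibre-discrete and fibre-cocompact. *)
Definition lattice_action (H : set (free_nil -> free_nil)) : Prop :=
  [/\ [/\ H id, forall g h, H g -> H h -> H (g \o h)
        & forall h, H h -> exists2 g, H g & cancel g h /\ cancel h g],
      forall h, H h -> translation free_cubes 1 h /\ free_continuous h,
      forall h x (i : 'I_k), H h -> (forall j : 'I_k, (j < i)%N -> h x j = x j) ->
        exists2 h', H h' & translation free_cubes i.+1 h' /\ h' x = h x,
      forall i, exists2 e : R, 0 < e & forall g, level_shifts H i g ->
        g.1 = 0 -> `|g.2| < e -> g = 0
    & forall i, exists B : R, forall w, exists2 g, level_shifts H i g &
        `|w.2 - g.2| <= B /\ forall l, `|(w.1 - g.1) 0 l|%:~R <= B].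

(* q identifies Y with the quotient of the free nilspace by H. *)
Definition free_quotient (H : set (free_nil -> free_nil)) (Y : cubespace)
    (q : free_nil -> Y) : Prop :=
  [/\ forall y, exists x, q x = y,
      forall x y, q x = q y <-> exists2 h, H h & y = h x,
      forall U : set Y, open U <-> forall z, open ((q \o free_sheet z) @^-1` U)
    & forall n (c : dcube n -> Y),
        cs_cubes Y n c <-> exists2 c', free_cubes c' & c = q \o c'].

Definition smooth_submersion (Y : topologicalType) n (At : set (@chart Y n))
    (q : free_nil -> Y) : Prop :=
  forall z c, At c ->
    smooth_on ((q \o free_sheet z) @^-1` dom c) (fwd c \o q \o free_sheet z) /\
    forall x, dom c (q (free_sheet z x)) ->
      forall w, exists v, 'D_v (fwd c \o q \o free_sheet z) x = w.

End Free.

(* The smooth structures on Y coming from a presentation Y = F / H. *)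
Definition nil_atlas (Y : cubespace) n (At : set (@chart Y n)) : Prop :=
  smooth_atlas At /\
  exists k a b H (q : @free_nil k a b -> Y),
    [/\ lattice_action H, free_quotient H q & smooth_submersion At q].

Definition is_cfr (X : cubespace) : Prop :=
  compact_nilspace X /\
  exists2 k, is_step (cs_cubes X) k &
    forall j, (1 <= j <= k)%N ->
      exists (A : topologicalZmodType) (act : nil_factor j X -> A -> nil_factor j X),
        is_structure_group j act /\ is_lie A.

Definition borel (T : ptopologicalType) := g_sigma_algebraType (@open T).

Definition haar_probability (A : topologicalZmodType) (mu : probability (borel (pointed_group A)) R)
    : Prop :=
  forall (a : A) (B : set (borel (pointed_group A))), measurable B ->
    mu [set x | B (a + x : A)] = mu B.

(* Borel probability measures on C^n(X), seen as measures on X^({0,1}^n). *)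
Definition cube_measure (X : cubespace) n :=
  {mu : probability (borel {ptws dcube n -> X}) R
      | mu (~` cs_cubes X n) = 0%E}.

Definition cube_integral (X : cubespace) n (mu : cube_measure X n)
    (h : borel {ptws dcube n -> X} -> R) : R :=
  \int[sval mu]_(c in (cs_cubes X n : set (borel {ptws dcube n -> X}))) h c.

(* mu is the Haar measure of C^n(X), for X a k-step compact nilspace; for k = 0
   the space X is a point. *)
Fixpoint cube_haar (k : nat) (X : cubespace) n (mu : cube_measure X n) : Prop :=
  match k with
  | 0 => True
  | j.+1 =>
    (exists (A : topologicalZmodType) (act : X -> A -> X),
       is_structure_group j.+1 act /\
       forall (d : dcube n -> A) (B : set (borel {ptws dcube n -> X})),
         Dcube j.+1 d -> measurable B ->
         sval mu [set c | B (fun v => act (c v) (d v))] = sval mu B) /\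
    exists2 nu : cube_measure (nil_factor j X) n, cube_haar j nu &
      forall B : set (borel {ptws dcube n -> nil_factor j X}), measurable B ->
        sval nu B = sval mu [set c : {ptws dcube n -> X} | B (@nil_pi j X \o c)]
  end.

(* dist is a metric generating the weak topology: the two have the same
   convergent filters. *)
Definition weak_metric X n (dist : cube_measure X n -> cube_measure X n -> R)
    : Prop :=
  [/\ forall mu nu, dist mu nu = 0 <->
        forall B, measurable B -> sval mu B = sval nu B,
      forall mu nu, dist mu nu = dist nu mu,
      forall mu nu xi, dist mu xi <= dist mu nu + dist nu xi
    & forall (Phi : set_system (cube_measure X n)) mu, ProperFilter Phi ->
        ((forall e, 0 < e -> Phi [set nu | dist nu mu < e]) <->
         (forall h : {ptws dcube n -> X} -> R,
            {within cs_cubes X n, continuous h} ->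
            (fun nu => cube_integral nu h) @ Phi --> cube_integral mu h))].

(* nu is the image of the uniform measure on C^n(Z) under phi^({0,1}^n). *)
Definition image_of_uniform (Z : finZmodType) (X : cubespace) n (phi : Z -> X)
    (nu : cube_measure X n) : Prop :=
  let CZ := [set c : {ffun dcube n -> Z} | `[< Dcube 1 (c : _ -> Z) >]]%SET in
  forall B : set (borel {ptws dcube n -> X}), measurable B ->
    sval nu B =
      (#|[set c in CZ | `[< B (phi \o c) >]]%SET|%:R / #|CZ|%:R)%:E.

Definition cintegral d (T : measurableType d) (mu : probability T R)
    (h : T -> R[i]) : R[i] :=
  (\int[mu]_(x in [set: T]) complex.Re (h x)
   +i* \int[mu]_(x in [set: T]) complex.Im (h x))%C.

Definition is_character (A : topologicalZmodType) (chi : A -> R[i]) : Prop :=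
  [/\ forall x y, chi (x + y) = chi x * chi y, forall x, cmod (chi x) = 1,
      continuous (fun x => complex.Re (chi x))
    & continuous (fun x => complex.Im (chi x))].

Definition fourier_part (X : Type) (A : topologicalZmodType) (act : X -> A -> X)
    (mu : probability (borel (pointed_group A)) R) (F : X -> R[i]) (chi : A -> R[i]) (x : X)
    : R[i] :=
  cintegral mu (fun z => F (act x z) * (chi z)^*).

Definition lipschitz_for (X : Type) (dist : X -> X -> R) (L : R)
    (F : X -> R[i]) : Prop :=
  forall x y, cmod (F x - F y) <= L * dist x y.

(* The nilspace of complexity i + 1 is [Y i]. The data indexed by k are
   relevant only when Y_i is k-step, with k >= 1: if k exceeds the least such
   value, the structure group Z_k(Y_i) is trivial. *)
Record choices := Choices {
  Y : nat -> cubespace;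
  Y_cfr : forall i, is_cfr (Y i);
  Y_enum : forall X, is_cfr X -> exists! i, nil_iso X (Y i);

  Zk : nat -> nat -> topologicalZmodType;
  Zact : forall i k, Y i -> Zk i k -> Y i;
  Zact_structure : forall i k, (0 < k)%N -> is_step (cs_cubes (Y i)) k ->
    is_structure_group k (@Zact i k);
  Zhaar : forall i k, probability (borel (pointed_group (Zk i k))) R;
  Zhaar_haar : forall i k, (0 < k)%N -> is_step (cs_cubes (Y i)) k ->
    haar_probability (Zhaar i k);

  Ydim : nat -> nat;
  Yatlas : forall i, set (@chart (Y i) (Ydim i));
  Yatlas_nil : forall i, nil_atlas (@Yatlas i);
  Ytensor : forall i, @chart (Y i) (Ydim i) -> 'rV[R]_(Ydim i) -> 'M[R]_(Ydim i);
  Ytensor_riemannian : forall i, riemannian (@Yatlas i) (@Ytensor i);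
  Ytensor_invariant : forall i k z, (0 < k)%N -> is_step (cs_cubes (Y i)) k ->
    tensor_preserved (@Yatlas i) (@Ytensor i) (fun y => @Zact i k y z);

  Yhaar : forall i n, cube_measure (Y i) n;
  Yhaar_haar : forall i k n, is_step (cs_cubes (Y i)) k ->
    cube_haar k (Yhaar i n);
  Ymetric : forall i n, cube_measure (Y i) n -> cube_measure (Y i) n -> R;
  Ymetric_weak : forall i n, weak_metric (@Ymetric i n);

  QY : nat -> R -> R -> nat;
  QY_spec : forall i k C delta, (0 < k)%N -> is_step (cs_cubes (Y i)) k ->
    0 < C -> 0 < delta ->
    exists S : {fset Zk i k -> R[i]},
      [/\ forall chi, chi \in S -> is_character chi, (#|` S| <= QY i delta C)%N
        & forall F : Y i -> R[i],
            lipschitz_for (geodesic_dist (@Yatlas i) (@Ytensor i)) C F ->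
            forall y, cmod (F y - \sum_(chi <- S)
              fourier_part (@Zact i k) (Zhaar i k) F chi y) <= delta]
}.

Section Decomposition.
Variable Ch : choices.

Definition Ydist i : Y Ch i -> Y Ch i -> R :=
  geodesic_dist (@Yatlas Ch i) (@Ytensor Ch i).

Definition balanced (Z : finZmodType) i (b : R) (phi : Z -> Y Ch i) : Prop :=
  forall n : nat, n%:R <= b^-1 ->
    exists2 nu, image_of_uniform phi nu & @Ymetric Ch i n nu (Yhaar Ch i n) <= b.

(* max_(i <= m) Q_(Y_i)(eta, m), the complexities starting at 1 *)
Definition Qmax (eta : R) (m : nat) : nat := \max_(i < m) QY Ch i eta m%:R.

Record regularity_decomposition (k : nat) (eta : R) (D : R -> nat -> R)
    (Z : finZmodType) (f : Z -> R[i]) (m : nat) := RegularityDecomposition {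
  rd_i : nat;
  rd_i_le : (rd_i < m)%N;
  rd_step : is_step (cs_cubes (Y Ch rd_i)) k;

  rd_phi : Z -> Y Ch rd_i;
  rd_phi_morphism : nil_morphism (@Dcube 1 Z) (cs_cubes (Y Ch rd_i)) rd_phi;
  rd_phi_balanced : balanced (D eta m) rd_phi;

  rd_F : Y Ch rd_i -> R[i];
  rd_F_bounded : bounded1 rd_F;
  rd_F_lipschitz : lipschitz_for (@Ydist rd_i) m%:R rd_F;

  rd_fs : Z -> R[i];
  rd_fe : Z -> R[i];
  rd_fr : Z -> R[i];
  rd_f_eq : forall x, f x = rd_fs x + rd_fe x + rd_fr x;
  rd_fs_eq : rd_fs = rd_F \o rd_phi;
  rd_fe_small : norm1 rd_fe <= eta;
  rd_fr_bounded : norm_sup rd_fr <= 1;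
  rd_fr_small : Num.max (gowers_norm k.+1 rd_fr)
    (Num.max (cmod (inner rd_fr rd_fs)) (cmod (inner rd_fr rd_fe))) <= D eta m;

  rd_S : {fset Zk Ch rd_i k -> R[i]};
  rd_S_character : forall chi, chi \in rd_S -> is_character chi;
  rd_S_card : (#|` rd_S| <= Qmax eta m)%N;
  rd_g := fun chi : Zk Ch rd_i k -> R[i] =>
    fourier_part (@Zact Ch rd_i k) (Zhaar Ch rd_i k) rd_F chi \o rd_phi;
  rd_ge : Z -> R[i];
  rd_fs_sum : forall x, rd_fs x = \sum_(chi <- rd_S) rd_g chi x + rd_ge x;
  rd_ge_small : norm_sup rd_ge <= eta;
  (* <g, g'>_(U^(k+1)) is a nonnegative real number for k >= 1. *)
  rd_quasi_orth : forall chi chi', chi \in rd_S -> chi' \in rd_S -> chi != chi' ->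
    Num.max (cmod (inner (rd_g chi) (rd_g chi')))
      (complex.Re (gowers_inner k (rd_g chi) (rd_g chi'))) <= D eta m
}.

(* N is a bound for which the regularity theorem of order k holds. *)
Definition regularity_bound (k : nat) (N : R -> (R -> nat -> R) -> nat) : Prop :=
  forall (eta : R) (D : R -> nat -> R),
    0 < eta -> (forall (e : R) m, 0 < e -> 0 < D e m) ->
  forall (Z : finZmodType) (f : Z -> R[i]), bounded1 f ->
  exists2 m, (1 <= m <= N eta D)%N &
    inhabited (regularity_decomposition k eta D f m).

End Decomposition.

End Smooth.

Arguments rd_g {R Ch k eta D Z f m} r chi x.

(* Main.v *)
(** Expand the Gowers average of f = f_s + f_e + f_r one vertex at a time.
    Replacing f by f_s costs 2^(k+1) terms in which a single vertex carries
    f_e + f_r and all the others 1-bounded functions: the f_e part is at most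
    ||f_e||_1 trivially, the f_r part at most ||f_r||_(U^(k+1)) by iterated
    Cauchy-Schwarz.  Replacing f_s by the sum of the g_chi is a pointwise
    estimate, the error g_e being uniformly small.  Multilinearity then gives
    one term for each assignment h of characters to the vertices of the cube.
    If h is not constant it separates the two ends of some edge, and
    Cauchy-Schwarz in the k other directions bounds the term by
    <g_chi, g_chi'>_(U^(k+1))^(1/2^k) for two distinct characters.

    This needs eta <= 1 and |g_chi| <= 1.  Bessel's inequality on the orbits of
    the last structure group yields sum_chi |g_chi(x)|^2 <= 1 at every point x,
    which contains the second condition and bounds the main term by 1; hence
    the error is at most 1, and for eta > 1 the right-hand side exceeds 1.
    Bessel's inequality requires F to be measurable along the orbits: being
    Lipschitz for the geodesic distance it is continuous, since straight
    segments in a chart have length comparable to their Euclidean length. *)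

Require Import Defs.
From HB Require Import structures.
From mathcomp Require Import all_boot all_order all_algebra finmap.
From mathcomp Require Import perm complex ring lra.
From mathcomp Require Import all_classical all_reals all_analysis.
From mathcomp Require Import measurable_realfun.
Set Implicit Arguments.
Unset Strict Implicit.
Unset Printing Implicit Defensive.
Import Order.TTheory GRing.Theory Num.Theory numFieldNormedType.Exports.
Local Open Scope classical_set_scope.
Local Open Scope ring_scope.

(** * Gowers averages *)

Section GowersAverage.
Variables (R : realType) (Z : finZmodType).

(** Precomposing a family of functions on the cube with [overwrite [:: i] w] copies the functions of
    the face v_i = w_i onto the opposite face, which is what one application of Cauchy-Schwarz in
    direction i does. *)
Definition overwrite n (s : seq 'I_n) (w v : dcube n) : dcube n :=
  [ffun j => if j \in s then w j else v j].

Definition flip n (i : 'I_n) (v : dcube n) : dcube n :=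
  [ffun j => v j (+) (j == i)].

Lemma flipK n (i : 'I_n) : involutive (flip i).
Proof. by move=> v; apply/ffunP => j; rewrite !ffunE -addbA addbb addbF. Qed.

Lemma overwrite_nil n (w : dcube n) : overwrite [::] w = id.
Proof. by apply/funext => v; apply/ffunP => j; rewrite ffunE. Qed.

Lemma overwrite_cons n j (s : seq 'I_n) (w : dcube n) :
  overwrite (j :: s) w = overwrite [:: j] w \o overwrite s w.
Proof.
apply/funext => v; apply/ffunP => l; rewrite !ffunE !inE.
by case: eqP => [->|_] //=.
Qed.

Lemma overwrite_enum n (w v : dcube n) : overwrite (enum 'I_n) w v = w.
Proof. by apply/ffunP => j; rewrite ffunE mem_enum. Qed.

Lemma overwrite1_id n i (w v : dcube n) : v i = w i -> overwrite [:: i] w v = v.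
Proof.
by move=> e; apply/ffunP => j; rewrite ffunE inE; case: eqP => // ->.
Qed.

Lemma overwrite1_flip n i (w v : dcube n) :
  v i = ~~ w i -> overwrite [:: i] w v = flip i v.
Proof.
move=> e; apply/ffunP => j; rewrite !ffunE inE.
by case: eqP => [->|_]; rewrite ?addbF // e addbT negbK.
Qed.

Lemma weight_flip n i (v : dcube n) : ~~ v i -> weight (flip i v) = (weight v).+1.
Proof.
move=> vi; rewrite /weight (bigD1 i) //= (bigD1 i (F := fun j => nat_of_bool (v j))) //=.
rewrite ffunE eqxx (negbTE vi) /= add1n add0n; congr _.+1.
by apply: eq_bigr => j /negbTE ji; rewrite ffunE ji addbF.
Qed.

Definition iconj (m : nat) : R[i] -> R[i] := iter m Num.conj.

Lemma iconjD m : {morph iconj m : x y / x + y}.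
Proof. by elim: m => // m IH x y; rewrite /iconj /= -/(iconj m) IH rmorphD. Qed.

Lemma iconjB m : {morph iconj m : x y / x - y}.
Proof. by elim: m => // m IH x y; rewrite /iconj /= -/(iconj m) IH rmorphB. Qed.

Lemma iconj0 m : iconj m 0 = 0.
Proof. by elim: m => // m IH; rewrite /iconj /= -/(iconj m) IH rmorph0. Qed.

Lemma norm_iconj m x : `|iconj m x| = `|x|.
Proof. by elim: m => // m IH; rewrite /iconj /= -/(iconj m) norm_conjC IH. Qed.

Definition vertex k (x : Z) (t : {ffun 'I_k -> Z}) (v : dcube k) : Z :=
  x + \sum_(i < k) t i *+ v i.

Lemma vertexC k x y (t : {ffun 'I_k -> Z}) v :
  vertex (x + y) t v = vertex x t v + y.
Proof. by rewrite /vertex addrAC. Qed.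

Definition shift k (i : 'I_k) (s : Z) (t : {ffun 'I_k -> Z}) : {ffun 'I_k -> Z} :=
  [ffun j => if j == i then t j + s else t j].

Lemma shiftK k (i : 'I_k) s : cancel (shift i (- s)) (shift i s).
Proof. by move=> t; apply/ffunP => j; rewrite !ffunE; case: eqP => // _; rewrite subrK. Qed.

Lemma shift_bij k (i : 'I_k) s : bijective (shift i s).
Proof.
exists (shift i (- s)); last exact: shiftK.
by move=> t; apply/ffunP => j; rewrite !ffunE; case: eqP => // _; rewrite addrK.
Qed.

Lemma vertex_shift k (i : 'I_k) s x t (v : dcube k) :
  vertex x (shift i s t) v = vertex x t v + s *+ v i.
Proof.
rewrite /vertex -addrA; congr (_ + _).
rewrite (bigD1 i) //= [X in _ = X + _](bigD1 i) //= ffunE eqxx mulrnDl.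
rewrite -!addrA; congr (_ + _); rewrite addrC; congr (_ + _).
by apply: eq_bigr => j /negbTE ji; rewrite ffunE ji.
Qed.

Lemma vertex_flip k (i : 'I_k) x t (v : dcube k) :
  ~~ v i -> vertex x t (flip i v) = vertex x t v + t i.
Proof.
move=> vi; rewrite /vertex -addrA; congr (_ + _).
rewrite (bigD1 i) //= [X in _ = X + _](bigD1 i) //= ffunE eqxx (negbTE vi) /=.
rewrite mulr0n add0r mulr1n addrC; congr (_ + _).
by apply: eq_bigr => j /negbTE ji; rewrite ffunE ji addbF.
Qed.

Definition cube_prod k (F : dcube k -> Z -> R[i]) x (t : {ffun 'I_k -> Z}) : R[i] :=
  \prod_(v : dcube k) iconj (weight v) (F v (vertex x t v)).

Lemma gowers_avgE k (F : dcube k -> Z -> R[i]) :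
  gowers_avg F = (\sum_x \sum_t cube_prod F x t) / (#|Z| ^ k.+1)%N%:R.
Proof. by []. Qed.

Lemma card_zmod_gt0 : (0 < #|Z|)%N.
Proof. by apply/card_gt0P; exists 0. Qed.

Lemma card_pow_gt0 k : (0 : R[i]) < (#|Z| ^ k)%N%:R.
Proof. by rewrite ltr0n expn_gt0 card_zmod_gt0. Qed.

Lemma sum_param_const k (c : R[i]) :
  \sum_(x : Z) \sum_(t : {ffun 'I_k -> Z}) c = c * (#|Z| ^ k.+1)%N%:R.
Proof.
by rewrite !sumr_const !cardT -!cardT -mulrnA card_ffun card_ord -expnSr mulr_natr.
Qed.

(** * Splitting a Gowers average along one direction *)

Section Face.
Variables (k : nat) (i : 'I_k) (F : dcube k -> Z -> R[i]).

(** For fixed t, the base point is summed separately on the two faces orthogonal to direction i;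
    Cauchy-Schwarz is applied to the products of these two sums. *)
Definition face_sum (b : bool) (t : {ffun 'I_k -> Z}) : R[i] :=
  \sum_x \prod_(v : dcube k | v i == b) iconj (weight v) (F v (vertex x t v)).

Lemma cube_prod_split x t : cube_prod F x t =
  (\prod_(v : dcube k | v i == false) iconj (weight v) (F v (vertex x t v))) *
  (\prod_(v : dcube k | v i == true) iconj (weight v) (F v (vertex x t v))).
Proof.
rewrite /cube_prod (bigID (fun v : dcube k => v i == false)) /=; congr (_ * _).
by apply: eq_bigl => v; case: (v i).
Qed.

(* Neither face sum depends on [t i]: the first because [v i = 0], the second
   by translation invariance of the sum over [x]. *)
Lemma sum_cube_prod : #|Z|%:R * (\sum_x \sum_t cube_prod F x t) =
  \sum_t face_sum false t * face_sum true t.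
Proof.
pose A x t := \prod_(v : dcube k | v i == false) iconj (weight v) (F v (vertex x t v)).
pose B x t := \prod_(v : dcube k | v i == true) iconj (weight v) (F v (vertex x t v)).
have shA s x t : A x (shift i s t) = A x t.
  by apply: eq_bigr => v /eqP vi; rewrite vertex_shift vi mulr0n addr0.
have shB s x t : B x (shift i s t) = B (x + s) t.
  by apply: eq_bigr => v /eqP vi; rewrite vertex_shift vi mulr1n vertexC.
(* The factor |Z| is spent on a free variable s: shifting t_i by s moves only the face v_i = 1, so
   the base points x and x + s of the two faces become independent. *)
transitivity (\sum_t \sum_x \sum_s A x t * B (x + s) t).
  rewrite [RHS]exchange_big /= mulr_sumr; apply: eq_bigr => x _.
  rewrite exchange_big /=.
  transitivity (\sum_(s : Z) \sum_t A x t * B x t).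
    rewrite sumr_const -[RHS]mulr_natl; congr (_ * _).
    by apply: eq_bigr => t _; rewrite cube_prod_split.
  apply: eq_bigr => s _; rewrite (reindex (shift i s)) /=; last first.
    exact/onW_bij/shift_bij.
  by apply: eq_bigr => t _; rewrite shA shB.
apply: eq_bigr => t _; rewrite /face_sum mulr_suml; apply: eq_bigr => x _.
rewrite -/(A x t) -mulr_sumr; congr (_ * _).
rewrite [RHS](reindex (fun s => x + s)) //=.
by apply/onW_bij; exists (fun s => - x + s) => s; rewrite ?addKr ?addNKr.
Qed.

End Face.

(** Crossing to the opposite face changes each weight by one, which costs one conjugation, and moves
    each vertex by t_i, which the sum over the base point absorbs. *)
Lemma face_sum_overwrite k (i : 'I_k) (F : dcube k -> Z -> R[i]) w b t :
  face_sum i (F \o overwrite [:: i] w) b t =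
  if b == w i then face_sum i F b t else (face_sum i F (w i) t)^*.
Proof.
case: eqP => [->|/eqP bw].
  apply: eq_bigr => x _; apply: eq_bigr => v /eqP vi /=.
  by rewrite overwrite1_id.
have {bw}-> : b = ~~ w i by case: (b) bw; case: (w i).
(* The sign of the displacement depends on the side from which the face is copied. *)
pose sg : bool -> Z := fun b => if b then t i else - t i.
rewrite /face_sum rmorph_sum [LHS](reindex (fun x => x + sg (w i))) /=; last first.
  by exists (fun x => x - sg (w i)) => x _; rewrite ?addrK ?subrK.
apply: eq_bigr => x _; rewrite rmorph_prod /= (reindex (flip i)) /=; last first.
  exact/onW_bij/inv_bij/flipK.
apply: eq_big => [v|v].
  by rewrite ffunE eqxx addbT (inj_eq negb_inj).
rewrite ffunE eqxx addbT => /eqP/negb_inj vi.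
have -> : overwrite [:: i] w (flip i v) = v.
  by rewrite overwrite1_flip ?flipK // ffunE eqxx addbT vi.
rewrite /sg vertexC; case: (boolP (w i)) vi => wi vi.
  have nf : ~~ flip i v i by rewrite ffunE eqxx vi.
  have := weight_flip nf; have := vertex_flip x t nf; rewrite flipK => -> ->.
  by rewrite /iconj /= conjCK.
by rewrite weight_flip ?vi // vertex_flip ?vi // addrK.
Qed.

(** * Cauchy-Schwarz in one direction *)

Section CauchySchwarz.
Variables (k : nat) (i : 'I_k).
Implicit Types F : dcube k -> Z -> R[i].

Lemma cardZ_neq0 : #|Z|%:R != 0 :> R[i].
Proof. by rewrite pnatr_eq0 -lt0n card_zmod_gt0. Qed.

Lemma gowers_avg_face F : gowers_avg F =
  (\sum_t face_sum i F false t * face_sum i F true t) / (#|Z| ^ k.+2)%N%:R.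
Proof.
rewrite -sum_cube_prod gowers_avgE [in RHS]expnS natrM invfM mulrACA.
by rewrite divff ?mul1r // cardZ_neq0.
Qed.

(** Once one face is copied onto the other, the two face sums are conjugate to each other. This is
    the source of the positivity of Gowers averages. *)
Lemma gowers_avg_overwrite F w : gowers_avg (F \o overwrite [:: i] w) =
  (\sum_t `|face_sum i F (w i) t| ^+ 2) / (#|Z| ^ k.+2)%N%:R.
Proof.
rewrite gowers_avg_face; congr (_ / _); apply: eq_bigr => t _.
rewrite !face_sum_overwrite normCK.
by case: (w i) => /=; rewrite // mulrC.
Qed.

Lemma gowers_avg_overwrite_ge0 F w : 0 <= gowers_avg (F \o overwrite [:: i] w).
Proof.
rewrite gowers_avg_overwrite divr_ge0 ?ler0n //.
by apply: sumr_ge0 => t _; rewrite exprn_ge0.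
Qed.

(** A family symmetric in direction i is its own overwrite in that direction. *)
Lemma gowers_avg_ge0 F :
  (forall v, F v = F (flip i v)) -> 0 <= gowers_avg F.
Proof.
move=> Fi; suff -> : F = F \o overwrite [:: i] (cube0 k).
  exact: gowers_avg_overwrite_ge0.
apply/funext => v /=; have [vi|vi] := boolP (v i).
  by rewrite overwrite1_flip ?ffunE // Fi.
by rewrite overwrite1_id // ffunE (negbTE vi).
Qed.


(** Lagrange's identity for the moduli: twice the difference of the two sides is a double sum of
    squares. *)
Lemma norm_sum_mul_sq (I : finType) (a b : I -> R[i]) :
  `|\sum_j a j * b j| ^+ 2 <= (\sum_j `|a j| ^+ 2) * (\sum_j `|b j| ^+ 2).
Proof.
apply: (@le_trans _ _ ((\sum_j `|a j| * `|b j|) ^+ 2)).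
  rewrite ler_pXn2r ?nnegrE ?normr_ge0 //; last first.
    by apply: sumr_ge0 => j _; rewrite mulr_ge0.
  by rewrite (le_trans (ler_norm_sum _ _ _)) // ler_sum // => j _; rewrite normrM.
have : 0 <= \sum_j \sum_l (`|a j| * `|b l| - `|a l| * `|b j|) ^+ 2.
  apply: sumr_ge0 => j _; apply: sumr_ge0 => l _.
  by rewrite real_exprn_even_ge0 // rpredB // rpredM // normr_real.
have -> : \sum_j \sum_l (`|a j| * `|b l| - `|a l| * `|b j|) ^+ 2 =
  ((\sum_j `|a j| ^+ 2) * (\sum_j `|b j| ^+ 2)
    - (\sum_j `|a j| * `|b j|) ^+ 2) *+ 2.
  under eq_bigr do under eq_bigr do rewrite sqrrB.
  under eq_bigr do rewrite big_split sumrB /=.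
  rewrite big_split sumrB /= expr2.
  have dist (u v : I -> R[i]) :
      (\sum_j u j) * (\sum_j v j) = \sum_j \sum_l u j * v l.
    by rewrite mulr_suml; apply: eq_bigr => j _; rewrite mulr_sumr.
  rewrite mulrnBl !dist.
  have e1 : \sum_j \sum_l (`|a j| * `|b l|) ^+ 2 =
            \sum_j \sum_l `|a j| ^+ 2 * `|b l| ^+ 2.
    by apply: eq_bigr => j _; apply: eq_bigr => l _; rewrite exprMn.
  have e2 : \sum_j \sum_l (`|a l| * `|b j|) ^+ 2 =
            \sum_j \sum_l `|a j| ^+ 2 * `|b l| ^+ 2.
    by rewrite exchange_big /=; apply: eq_bigr => j _; apply: eq_bigr => l _; rewrite exprMn.
  have e3 : \sum_j \sum_l `|a j| * `|b l| * (`|a l| * `|b j|) *+ 2 =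
            (\sum_j \sum_l `|a j| * `|b j| * (`|a l| * `|b l|)) *+ 2.
    rewrite -sumrMnl; apply: eq_bigr => j _; rewrite -sumrMnl.
    by apply: eq_bigr => l _; congr (_ *+ _); ring.
  by rewrite e1 e2 e3 mulr2n -addrA addrC -addrA addrC; ring.
by rewrite pmulrn_lge0 // subr_ge0.
Qed.

(** Cauchy-Schwarz over t, applied to the two face sums; each factor on the right comes from copying
    one of the two faces. *)
Lemma gowers_avg_cauchy_schwarz F w : `|gowers_avg F| ^+ 2 <=
  gowers_avg (F \o overwrite [:: i] w) *
  gowers_avg (F \o overwrite [:: i] (flip i w)).
Proof.
rewrite !gowers_avg_overwrite gowers_avg_face normf_div expr_div_n.
rewrite mulrACA -invfM -expr2 normr_nat ler_pM2r ?invr_gt0 ?exprn_gt0 ?card_pow_gt0 //.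
rewrite ffunE eqxx addbT; apply: le_trans (norm_sum_mul_sq _ _) _.
by case: (w i) => //=; rewrite mulrC.
Qed.

End CauchySchwarz.

(** The counterpart of [bounded1] for the modulus with values in R[i], so that the estimates can
    stay in the partially ordered field R[i]. *)
Definition unit_bounded (T : Type) (f : T -> R[i]) := forall x, `|f x| <= 1.

(** * Iterated Cauchy-Schwarz and telescoping for bounded functions *)

Section Bounded.
Variable k : nat.
Implicit Types F : dcube k -> Z -> R[i].

Lemma norm_gowers_avg_le F c :
  (forall x t, `|cube_prod F x t| <= c) -> `|gowers_avg F| <= c.
Proof.
move=> Fc; rewrite gowers_avgE normf_div normr_nat ler_pdivrMr ?card_pow_gt0 //.
rewrite -sum_param_const (le_trans (ler_norm_sum _ _ _)) //.
apply: ler_sum => x _; rewrite (le_trans (ler_norm_sum _ _ _)) //.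
by apply: ler_sum => t _.
Qed.

Lemma norm_cube_prod F x t :
  `|cube_prod F x t| = \prod_v `|F v (vertex x t v)|.
Proof. by rewrite normr_prod; apply: eq_bigr => v _; rewrite norm_iconj. Qed.

Lemma norm_cube_prod_le F x t (P : pred (dcube k)) :
  (forall v, ~~ P v -> unit_bounded (F v)) ->
  `|cube_prod F x t| <= \prod_(v | P v) `|F v (vertex x t v)|.
Proof.
move=> F1; rewrite norm_cube_prod (bigID P) /= ler_piMr ?prodr_ge0 //.
by apply: prodr_ile1 => v /F1 Fv; rewrite normr_ge0 Fv.
Qed.

Lemma norm_gowers_avg_le1 F : (forall v, unit_bounded (F v)) -> `|gowers_avg F| <= 1.
Proof.
move=> F1; apply: norm_gowers_avg_le => x t.
by rewrite (le_trans (@norm_cube_prod_le _ _ _ pred0 _)) ?big_pred0 // => v _; exact: F1.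
Qed.

(** One Cauchy-Schwarz per direction in [s]. Each time the second factor is an average of 1-bounded
    functions and is discarded. *)
Lemma gowers_avg_le_overwrite F s w : (forall v, unit_bounded (F v)) ->
  `|gowers_avg F| ^+ (2 ^ size s) <= `|gowers_avg (F \o overwrite s w)|.
Proof.
elim: s F => [|j s IH] F F1; first by rewrite overwrite_nil expr1.
rewrite overwrite_cons /= expnS exprM.
apply: le_trans (IH (F \o overwrite [:: j] w) _); last by move=> v; apply: F1.
rewrite lerXn2r ?nnegrE ?exprn_ge0 //.
apply: le_trans (gowers_avg_cauchy_schwarz j F w) _.
rewrite [leRHS]ger0_norm ?gowers_avg_overwrite_ge0 //.
rewrite ler_piMr ?gowers_avg_overwrite_ge0 //.
rewrite -[leLHS]ger0_norm ?gowers_avg_overwrite_ge0 //.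
by rewrite norm_gowers_avg_le1 // => v; apply: F1.
Qed.

(** After all k directions have been used, every vertex carries the function that stood at v. *)
Lemma gowers_avg_le_const F v : (forall v, unit_bounded (F v)) ->
  `|gowers_avg F| ^+ (2 ^ k) <= `|gowers_avg (fun _ : dcube k => F v)|.
Proof.
move=> F1; have := gowers_avg_le_overwrite (enum 'I_k) v F1.
rewrite size_enum_ord; congr (_ <= `|gowers_avg _|).
by apply/funext => w /=; rewrite overwrite_enum.
Qed.

(** Only the factor at v is kept; for fixed t its argument runs through Z exactly once as x does. *)
Lemma norm_gowers_avg_le_norm1 F v :
  (forall w, w != v -> unit_bounded (F w)) ->
  `|gowers_avg F| <= (\sum_x `|F v x|) / #|Z|%:R.
Proof.
move=> F1; rewrite gowers_avgE normf_div normr_nat ler_pdivrMr ?card_pow_gt0 //.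
rewrite (le_trans (ler_norm_sum _ _ _)) //.
apply: (@le_trans _ _ (\sum_x \sum_t `|F v (vertex x t v)|)).
  apply: ler_sum => x _; rewrite (le_trans (ler_norm_sum _ _ _)) //.
  apply: ler_sum => t _; apply: le_trans (@norm_cube_prod_le _ x t (pred1 v) F1) _.
  by rewrite big_pred1_eq.
rewrite exchange_big /= expnS natrM mulrA divfK ?cardZ_neq0 //.
have tr t : \sum_x `|F v (vertex x t v)| = \sum_x `|F v x|.
  rewrite [RHS](reindex (fun x => vertex x t v)) //=.
  exists (fun x => x - (\sum_(i < k) t i *+ v i)) => x _;
    by rewrite /vertex ?addrK ?subrK.
under eq_bigr do rewrite tr.
by rewrite sumr_const card_ffun card_ord mulr_natr.
Qed.

Definition set_at F v f : dcube k -> Z -> R[i] :=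
  fun w => if w == v then f else F w.

Lemma gowers_avg_set_atB F v f g :
  gowers_avg (set_at F v (f \- g)) =
  gowers_avg (set_at F v f) - gowers_avg (set_at F v g).
Proof.
rewrite !gowers_avgE -mulrBl -sumrB; congr (_ / _); apply: eq_bigr => x _.
rewrite -sumrB; apply: eq_bigr => t _; rewrite /cube_prod.
rewrite (bigD1 v) //= [in RHS](bigD1 v) //= [X in _ = _ - X](bigD1 v) //=.
rewrite /set_at eqxx iconjB mulrBl; congr (_ * _ - _ * _);
  by apply: eq_bigr => w /negbTE wv; rewrite wv.
Qed.

Lemma gowers_avg_set_atD F v f g :
  gowers_avg (set_at F v (f \+ g)) =
  gowers_avg (set_at F v f) + gowers_avg (set_at F v g).
Proof.
have -> : f = (f \+ g) \- g by apply/funext => x; rewrite /= addrK.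
rewrite gowers_avg_set_atB subrK; congr gowers_avg; congr set_at.
by apply/funext => x /=; rewrite subrK.
Qed.

Lemma set_at_id F v : set_at F v (F v) = F.
Proof. by apply/funext => w; rewrite /set_at; case: eqP => [->|]. Qed.

(** The 2^k vertices are switched from [a] to [b] one at a time. By linearity at the switched
    vertex, each switch changes the average by one with [a \- b] there and 1-bounded functions
    elsewhere. *)
Lemma gowers_avg_telescope a b (delta : R[i]) :
  unit_bounded a -> unit_bounded b ->
  (forall F v, F v = a \- b -> (forall w, w != v -> unit_bounded (F w)) ->
     `|gowers_avg F| <= delta) ->
  `|gowers_avg (fun _ : dcube k => a) - gowers_avg (fun _ : dcube k => b)|
     <= (2 ^ k)%N%:R * delta.
Proof.
move=> a1 b1 H.
pose G (s : seq (dcube k)) w := if w \in s then b else a.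
have -> : (fun _ => b) = G (enum {: dcube k}).
  by apply/funext => w; rewrite /G mem_enum.
have -> : (2 ^ k)%N = size (enum {: dcube k}).
  by rewrite -cardE card_ffun card_ord card_bool.
(* Uniqueness of the list ensures that a vertex still carries [a] when its turn comes. *)
elim: (enum _) (enum_uniq {: dcube k}) => [|v s IH] /=.
  by rewrite subrr normr0 mul0r.
case/andP => vs /IH{}IH.
have -> : gowers_avg (fun _ : dcube k => a) - gowers_avg (G (v :: s)) =
    (gowers_avg (fun _ : dcube k => a) - gowers_avg (G s)) + gowers_avg (set_at (G s) v (a \- b)).
  rewrite gowers_avg_set_atB.
  have -> : set_at (G s) v a = G s.
    by rewrite -[RHS](set_at_id _ v) {3}/G (negbTE vs).
  have -> : set_at (G s) v b = G (v :: s).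
    by apply/funext => w; rewrite /set_at /G inE; case: eqP.
  by rewrite addrA subrK.
apply: le_trans (ler_normD _ _) _.
rewrite -natr1 mulrDl mul1r lerD //; apply: (H _ v); first by rewrite /set_at eqxx.
by move=> w /negbTE wv; rewrite /set_at wv /G; case: ifP.
Qed.

End Bounded.

Section Permutation.
Variables (k : nat) (s : 'S_k).

Definition dcube_perm (v : dcube k) : dcube k := [ffun j => v (s j)].

(** Permuting the parameters t together with the coordinates changes nothing. This lets any
    direction play the part of the last one, which [gowers_inner] singles out. *)
Lemma gowers_avg_perm (F : dcube k -> Z -> R[i]) :
  gowers_avg (F \o dcube_perm) = gowers_avg F.
Proof.
pose q (T : Type) (u : 'S_k) (v : {ffun 'I_k -> T}) := [ffun j => v (u j)].
have qK (T : Type) (u : 'S_k) : cancel (@q T u) (q T u^-1)%g.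
  by move=> v; apply/ffunP => j; rewrite !ffunE permKV.
have qKV (T : Type) (u : 'S_k) : cancel (q T u^-1)%g (@q T u).
  by move=> v; apply/ffunP => j; rewrite !ffunE permK.
rewrite !gowers_avgE; congr (_ / _); apply: eq_bigr => x _.
rewrite [RHS](reindex (@q Z s)) /=; last first.
  by apply/onW_bij; exists (q Z s^-1)%g.
apply: eq_bigr => t _; rewrite /cube_prod.
rewrite [RHS](reindex (@q bool s)) /=; last first.
  by apply/onW_bij; exists (q bool s^-1)%g.
apply: eq_bigr => v _; congr (iconj _ (F _ _)).
  rewrite /weight [LHS](reindex_perm s) /=.
  by apply: eq_bigr => j _; rewrite ffunE.
rewrite /vertex; congr (_ + _).
by rewrite [LHS](reindex_perm s) /=; apply: eq_bigr => j _; rewrite !ffunE.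
Qed.

End Permutation.

(** The family depends on the last coordinate only, so for 0 < k it is symmetric in the first
    direction. *)
Lemma gowers_inner_ge0 k (f g : Z -> R[i]) : (0 < k)%N -> 0 <= gowers_inner k f g.
Proof.
move=> k0; apply: (@gowers_avg_ge0 _ ord0) => v; rewrite ffunE.
by rewrite -val_eqE /= eqn0Ngt k0 addbF.
Qed.

Lemma gowers_avg_const_ge0 k (f : Z -> R[i]) : (0 < k)%N ->
  0 <= gowers_avg (fun _ : dcube k => f).
Proof. by case: k => // k _; exact: (@gowers_avg_ge0 _ ord0). Qed.

(** Cauchy-Schwarz in every direction except i leaves only the functions at the two ends of the edge
    through w in direction i; a transposition then makes i the last direction. *)
Lemma gowers_avg_le_inner k (F : dcube k.+1 -> Z -> R[i]) w i :
  (forall v, unit_bounded (F v)) ->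
  `|gowers_avg F| ^+ (2 ^ k) <=
  `|gowers_inner k (F (overwrite [:: i] (cube0 _) w))
                   (F (overwrite [:: i] (cube1 _) w))|.
Proof.
move=> F1; have := gowers_avg_le_overwrite (enum (predC1 i)) w F1.
rewrite -cardE cardC1 card_ord /=; congr (_ <= `| _ |).
rewrite /gowers_inner -[RHS](gowers_avg_perm (tperm i ord_max)).
congr gowers_avg; apply/funext => v /=; rewrite ffunE tpermR.
case: ifP => vi; congr F; apply/ffunP => j; rewrite !ffunE mem_enum !inE;
  by case: eqP => //= ->; rewrite vi.
Qed.

(** The cube is connected through its edges. Contrapositively, a non-constant assignment takes
    different values at the ends of some edge. *)
Lemma flip_invariant_const k (T : Type) (h : dcube k -> T) :
  (forall v i, h (flip i v) = h v) -> forall v, h v = h (cube0 k).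
Proof.
move=> hi v; rewrite -[in RHS](overwrite_enum (cube0 k) v).
elim: (enum _) => [|j s IH]; first by rewrite overwrite_nil.
rewrite overwrite_cons /=.
have [e|e] := eqVneq (overwrite s (cube0 k) v j) (cube0 k j).
  by rewrite overwrite1_id.
rewrite overwrite1_flip ?hi //.
by move: e; rewrite [cube0 k j]ffunE; case: (overwrite s (cube0 k) v j).
Qed.

(** For 0 < k the average is nonnegative, so raising to the power 2^k undoes the root. *)
Lemma gowers_normX k (f : Z -> R[i]) : (0 < k)%N ->
  gowers_norm k f ^+ (2 ^ k) = complex.Re (gowers_avg (fun _ : dcube k => f)).
Proof.
move=> /(gowers_avg_const_ge0 f); rewrite lecE => /andP[_ /= P0].
rewrite /gowers_norm -powR_mulrn ?powR_ge0 // -powRrM div1r mulVf ?powRr1 //.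
Qed.

(** * Multilinear expansion of the average of a sum *)

Section Expansion.
Variables (k : nat) (I : finType) (G : I -> Z -> R[i]).

Lemma gowers_avg_sum :
  gowers_avg (fun (_ : dcube k) x => \sum_c G c x) =
  \sum_(h : {ffun dcube k -> I}) gowers_avg (fun v => G (h v)).
Proof.
rewrite gowers_avgE; under [RHS]eq_bigr do rewrite gowers_avgE.
rewrite -mulr_suml; congr (_ / _); rewrite [RHS]exchange_big /=.
apply: eq_bigr => x _; rewrite [RHS]exchange_big /=; apply: eq_bigr => t _.
rewrite -(bigA_distr_bigA (fun v c => iconj (weight v) (G c (vertex x t v)))).
apply: eq_bigr => v _.
by apply: (big_morph _ (iconjD _) (iconj0 _)).
Qed.

(** The constant assignments form the diagonal sum; every other one separates the ends of some edge
    and is bounded by [delta]. *)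
Lemma gowers_avg_sum_diag (delta : R[i]) : 0 <= delta ->
  (forall (h : dcube k -> I) v i, h v != h (flip i v) ->
     `|gowers_avg (fun v => G (h v))| <= delta) ->
  `|gowers_avg (fun (_ : dcube k) x => \sum_c G c x) -
    \sum_c gowers_avg (fun _ : dcube k => G c)| <=
  (#|I| ^ (2 ^ k) - 1)%N%:R * delta.
Proof.
move=> d0 H; rewrite gowers_avg_sum.
pose cst c : {ffun dcube k -> I} := [ffun=> c].
rewrite (bigID (fun h : {ffun dcube k -> I} => cst (h (cube0 k)) == h)) /=.
rewrite (reindex_onto cst (fun h => h (cube0 k))) /=; last by move=> h /eqP.
have -> : \sum_(c | (cst (cst c (cube0 k)) == cst c) && (cst c (cube0 k) == c))
    gowers_avg (fun v => G (cst c v)) = \sum_c gowers_avg (fun _ : dcube k => G c).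
  apply: eq_big => c; first by rewrite /cst !ffunE !eqxx.
  by move=> _; congr gowers_avg; apply/funext => v; rewrite ffunE.
rewrite addrAC subrr add0r (le_trans (ler_norm_sum _ _ _)) //.
apply: (@le_trans _ _ (\sum_(h : {ffun dcube k -> I} | cst (h (cube0 k)) != h) delta)).
  apply: ler_sum => h hn.
  have [/existsP[v /existsP[i hi]]|] :=
      boolP [exists v, exists i, h v != h (flip i v)].
    exact: (H h v i).
  move/existsPn => hc; case/eqP: hn; apply/ffunP => v; rewrite ffunE.
  apply/esym/flip_invariant_const => {}v i.
  by have /existsPn/(_ i) := hc v; rewrite negbK => /eqP.
rewrite sumr_const -[leLHS]mulr_natl ler_wpM2r // ler_nat.
(* If [I] is empty there is no assignment at all, in accordance with the truncated subtraction 0 - 1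
   = 0. *)
have [c _|I0] := pickP (mem I); last first.
  rewrite (_ : #|_| = 0%N) // ; apply/eq_card0 => h.
  by have := I0 (h (cube0 k)).
(* Excluding a single constant assignment already accounts for the - 1. *)
apply: (@leq_trans #|predC1 (cst c)|).
  apply: subset_leq_card; apply/fintype.subsetP => h; rewrite !inE.
  by apply: contra => /eqP ->; rewrite /cst !ffunE.
by rewrite cardC1 !card_ffun card_ord card_bool subn1.
Qed.

End Expansion.

(** Since |b_j| <= 1 + eta <= 2, adding a factor turns an error e into at most eta + 2 e, and (2^n -
    1) eta solves this recursion. *)
Lemma prod_dist_le (T : Type) (r : seq T) (a b : T -> R[i]) (eta : R[i]) :
  0 <= eta <= 1 -> unit_bounded a -> (forall j, `|a j - b j| <= eta) ->
  `|\prod_(j <- r) a j - \prod_(j <- r) b j| <= (2 ^+ size r - 1) * eta.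
Proof.
move=> /andP[eta0 eta1] a1 ab; elim: r => [|j r IH].
  by rewrite !big_nil !subrr normr0 mul0r.
rewrite !big_cons; set pa := \prod_(j <- r) a j in IH *.
set pb := \prod_(j <- r) b j in IH *.
have pa1 : `|pa| <= 1.
  by rewrite normr_prod; apply: prodr_ile1 => l _; rewrite normr_ge0 a1.
have p2 : 1 <= 2 ^+ size r :> R[i] by rewrite exprn_ege1 // ler1n.
have -> : a j * pa - b j * pb = (a j - b j) * pa + b j * (pa - pb) by ring.
have bj : `|b j| <= 1 + eta.
  have -> : b j = a j - (a j - b j) by ring.
  by rewrite (le_trans (ler_normB _ _)) // lerD.
have -> : (2 ^+ size (j :: r) - 1) * eta =
    eta + (1 + 1) * ((2 ^+ size r - 1) * eta) by rewrite /= exprS; ring.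
rewrite (le_trans (ler_normD _ _)) // !normrM lerD //.
  by rewrite (le_trans (ler_piMr _ pa1)).
rewrite ler_pM //; exact: (le_trans bj (lerD _ _)).
Qed.

Lemma gowers_avg_dist_le k (a b : Z -> R[i]) (eta : R[i]) :
  0 <= eta <= 1 -> unit_bounded a -> (forall x, `|a x - b x| <= eta) ->
  `|gowers_avg (fun _ : dcube k => a) - gowers_avg (fun _ : dcube k => b)|
    <= (2 ^+ (2 ^ k) - 1) * eta.
Proof.
move=> eta01 a1 ab; rewrite !gowers_avgE -mulrBl -sumrB normf_div normr_nat.
rewrite ler_pdivrMr ?card_pow_gt0 // -sum_param_const.
rewrite (le_trans (ler_norm_sum _ _ _)) //; apply: ler_sum => x _.
rewrite -sumrB (le_trans (ler_norm_sum _ _ _)) //; apply: ler_sum => t _.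
have -> : (2 ^ k)%N = size (index_enum (dcube k)).
  by rewrite -[index_enum _]enumT -cardE card_ffun card_ord card_bool.
apply: prod_dist_le => // v; first by rewrite norm_iconj.
by rewrite -iconjB norm_iconj.
Qed.

(** In each product all factors are dropped except those at two adjacent vertices. The
    arithmetic-geometric mean inequality separates these two, and the pointwise bound on the sum of
    squares applies at each. *)
Lemma sum_gowers_avg_le1 k (I : finType) (G : I -> Z -> R[i]) :
  (forall x, \sum_c `|G c x| ^+ 2 <= 1) ->
  `|\sum_c gowers_avg (fun _ : dcube k.+1 => G c)| <= 1.
Proof.
move=> G1.
have Gu c : unit_bounded (G c).
  move=> x; rewrite -(@expr_le1 _ 2) //; apply: le_trans (G1 x).
  by rewrite (bigD1 c) //= lerDl sumr_ge0 // => d _; rewrite exprn_ge0.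
under eq_bigr do rewrite gowers_avgE.
rewrite -mulr_suml normf_div normr_nat ler_pdivrMr ?card_pow_gt0 //.
rewrite -(sum_param_const k.+1) exchange_big /= (le_trans (ler_norm_sum _ _ _)) //.
apply: ler_sum => x _; rewrite exchange_big (le_trans (ler_norm_sum _ _ _)) //.
apply: ler_sum => t _; rewrite (le_trans (ler_norm_sum _ _ _)) //.
pose u := vertex x t (cube0 k.+1); pose w := vertex x t (flip ord0 (cube0 k.+1)).
have n0 : flip ord0 (cube0 k.+1) != cube0 k.+1.
  by apply/eqP => /ffunP/(_ ord0); rewrite !ffunE eqxx.
apply: (@le_trans _ _ (\sum_c (`|G c u| ^+ 2 + `|G c w| ^+ 2) / 2)).
  apply: ler_sum => c _.
  have := @norm_cube_prod_le _ (fun=> G c) x t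
    (pred2 (cube0 k.+1) (flip ord0 (cube0 k.+1))) (fun _ _ => Gu c).
  move/le_trans; apply.
  rewrite (bigD1 (cube0 k.+1)) /= ?eqxx // (big_pred1 (flip ord0 (cube0 k.+1))).
    rewrite -/u -/w ler_pdivlMr // -subr_ge0.
    have -> : `|G c u| ^+ 2 + `|G c w| ^+ 2 - `|G c u| * `|G c w| * 2 =
      (`|G c u| - `|G c w|) ^+ 2 by ring.
    by rewrite real_exprn_even_ge0 // rpredB // normr_real.
  move=> v /=; case: eqVneq => [->|]; rewrite ?andbT ?andbF //.
  by rewrite eq_sym (negbTE n0).
rewrite -mulr_suml big_split /= ler_pdivrMr // mul1r.
by rewrite (_ : 2 = 1 + 1) // lerD.
Qed.

(** * The error estimate for an abstract decomposition *)

Section Decomposition.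
Variables (k : nat) (I : finType) (G : I -> Z -> R[i]).
Variables (fs fe fr ge : Z -> R[i]) (eta D delta : R[i]).
Hypotheses (D0 : 0 <= D) (delta0 : 0 <= delta) (eta01 : 0 <= eta <= 1).
Hypothesis f1 : unit_bounded (fs \+ (fe \+ fr)).
Hypotheses (fs1 : unit_bounded fs) (fr1 : unit_bounded fr).
Hypothesis fe_small : (\sum_x `|fe x|) / #|Z|%:R <= eta.
Hypothesis fr_small : `|gowers_avg (fun _ : dcube k.+1 => fr)| <= D ^+ (2 ^ k.+1).
Hypothesis fsE : fs = (fun x => \sum_c G c x + ge x).
Hypothesis ge_small : forall x, `|ge x| <= eta.
Hypothesis G1 : forall c, unit_bounded (G c).
Hypothesis G_orth : forall c c', c != c' -> `|gowers_inner k (G c) (G c')| <= delta ^+ (2 ^ k).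

(** The three summands bound the passages from f to [fs], from [fs] to the sum of the [G c], and
    from that sum to its diagonal terms. The hypotheses bound averages by powers of [D] and [delta],
    so that no root is taken in R[i]. *)
Lemma gowers_avg_decomposition :
  `|gowers_avg (fun _ : dcube k.+1 => fs \+ (fe \+ fr)) -
    \sum_c gowers_avg (fun _ : dcube k.+1 => G c)| <=
  (2 ^ k.+1)%N%:R * (eta + D) + (2 ^+ (2 ^ k.+1) - 1) * eta +
  (#|I| ^ (2 ^ k.+1) - 1)%N%:R * delta.
Proof.
set Pf := gowers_avg _; set S := \sum_c _.
pose Ps := gowers_avg (fun _ : dcube k.+1 => fs).
pose PA := gowers_avg (fun (_ : dcube k.+1) x => \sum_c G c x).
have -> : Pf - S = (Pf - Ps) + (Ps - PA) + (PA - S) by ring.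
rewrite (le_trans (ler_normD _ _)) // lerD //; last first.
  apply: gowers_avg_sum_diag => // h v i hi.
  rewrite -(@ler_pXn2r _ (2 ^ k)) ?nnegrE ?expn_gt0 //.
  apply: le_trans (gowers_avg_le_inner v i _) _; first by move=> ?; apply: G1.
  apply: G_orth.
  (* Which end of the separating edge lies on the face v_i = 0 depends on v. *)
  have [vi|vi] := boolP (v i).
    rewrite overwrite1_flip ?ffunE ?vi // overwrite1_id ?ffunE //.
    by rewrite eq_sym.
  rewrite (overwrite1_id (w := cube0 _)) ?ffunE ?(negbTE vi) //.
  by rewrite overwrite1_flip // ffunE; apply: negbTE.
rewrite (le_trans (ler_normD _ _)) // lerD //; last first.
  apply: gowers_avg_dist_le => // x; rewrite fsE.
  by rewrite addrAC subrr add0r.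
apply: gowers_avg_telescope => // F v Fv F1.
have {Fv} : F v = fe \+ fr.
  by rewrite Fv; apply/funext => x /=; rewrite addrAC subrr add0r.
(* At the exceptional vertex, [fe] is controlled in mean by the trivial bound, and [fr] through its
   own Gowers average by iterated Cauchy-Schwarz. *)
move=> Fv; rewrite -(set_at_id F v) Fv gowers_avg_set_atD.
rewrite (le_trans (ler_normD _ _)) // lerD //.
  apply: le_trans (norm_gowers_avg_le_norm1 (v := v) _) _.
    by move=> w wv; rewrite /set_at (negbTE wv); exact: F1.
  by rewrite /set_at eqxx.
rewrite -(@ler_pXn2r _ (2 ^ k.+1)) ?nnegrE ?expn_gt0 //.
apply: le_trans fr_small.
apply: le_trans (gowers_avg_le_const v _) _.
  by move=> w; rewrite /set_at; case: eqVneq => // /F1.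
by rewrite /set_at eqxx.
Qed.

End Decomposition.
End GowersAverage.

(** * Complex integrals and Bessel's inequality *)

Section ComplexIntegral.
Variables (R : realType) (d : measure_display) (T : measurableType d).
Variable mu : probability T R.
Implicit Types h g : T -> R[i].

Lemma ReD (x y : R[i]) : complex.Re (x + y) = complex.Re x + complex.Re y.
Proof. by case: x y => [? ?] []. Qed.

Lemma ImD (x y : R[i]) : complex.Im (x + y) = complex.Im x + complex.Im y.
Proof. by case: x y => [? ?] []. Qed.

Lemma ReM (x y : R[i]) : complex.Re (x * y) =
  complex.Re x * complex.Re y - complex.Im x * complex.Im y.
Proof. by case: x y => [? ?] []. Qed.

Lemma ImM (x y : R[i]) : complex.Im (x * y) =
  complex.Re x * complex.Im y + complex.Im x * complex.Re y.
Proof. by case: x y => [? ?] []. Qed.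

Lemma ReJ (x : R[i]) : complex.Re x^* = complex.Re x.
Proof. by case: x. Qed.

Lemma ImJ (x : R[i]) : complex.Im x^* = - complex.Im x.
Proof. by case: x. Qed.

Lemma complex_ext (x y : R[i]) :
  complex.Re x = complex.Re y -> complex.Im x = complex.Im y -> x = y.
Proof. by case: x y => [? ?] [? ?] /= -> ->. Qed.

(** A class of integrands closed under sums, products and conjugation, on which [cintegral] is
    linear. *)
Definition bounded_measurable h : Prop :=
  [/\ measurable_fun setT (@complex.Re R \o h), measurable_fun setT (@complex.Im R \o h)
    & exists M : R, forall x, `|complex.Re (h x)| <= M /\ `|complex.Im (h x)| <= M].

Lemma bounded_measurable_cst c : bounded_measurable (fun=> c).
Proof.
split; [exact: measurable_cst|exact: measurable_cst|].
by exists (Num.max `|complex.Re c| `|complex.Im c|) => x; rewrite !le_max !lexx orbT.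
Qed.

Lemma bounded_measurableD h g : bounded_measurable h -> bounded_measurable g ->
  bounded_measurable (fun x => h x + g x).
Proof.
move=> [mh1 mh2 [M hM]] [mg1 mg2 [N gN]]; split.
- rewrite (_ : _ \o _ = (@complex.Re R \o h) \+ (@complex.Re R \o g)).
    exact: measurable_funD.
  by apply/funext => x /=; rewrite ReD.
- rewrite (_ : _ \o _ = (@complex.Im R \o h) \+ (@complex.Im R \o g)).
    exact: measurable_funD.
  by apply/funext => x /=; rewrite ImD.
exists (M + N) => x; have [? ?] := hM x; have [? ?] := gN x.
by rewrite ReD ImD; split; rewrite (le_trans (ler_normD _ _)) // lerD.
Qed.

Lemma bounded_measurableJ h : bounded_measurable h ->
  bounded_measurable (fun x => (h x)^*).
Proof.
move=> [mh1 mh2 [M hM]]; split.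
- by rewrite (_ : _ \o _ = @complex.Re R \o h) //; apply/funext => x /=; rewrite ReJ.
- rewrite (_ : _ \o _ = \- (@complex.Im R \o h)); first exact: measurable_funN.
  by apply/funext => x /=; rewrite ImJ.
by exists M => x; rewrite ReJ ImJ normrN.
Qed.

Lemma bounded_measurableM h g : bounded_measurable h -> bounded_measurable g ->
  bounded_measurable (fun x => h x * g x).
Proof.
move=> [mh1 mh2 [M hM]] [mg1 mg2 [N gN]]; split.
- rewrite (_ : _ \o _ = ((@complex.Re R \o h) \* (@complex.Re R \o g)) \-
                        ((@complex.Im R \o h) \* (@complex.Im R \o g))).
    by apply: measurable_funB; exact: measurable_funM.
  by apply/funext => x /=; rewrite ReM.
- rewrite (_ : _ \o _ = ((@complex.Re R \o h) \* (@complex.Im R \o g)) \+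
                        ((@complex.Im R \o h) \* (@complex.Re R \o g))).
    by apply: measurable_funD; exact: measurable_funM.
  by apply/funext => x /=; rewrite ImM.
exists (M * N + M * N) => x; have [? ?] := hM x; have [? ?] := gN x.
rewrite ReM ImM; split.
  by rewrite (le_trans (ler_normB _ _)) // lerD // normrM ler_pM.
by rewrite (le_trans (ler_normD _ _)) // lerD // normrM ler_pM.
Qed.

Lemma bounded_measurable_sum (I : finType) (h : I -> T -> R[i]) :
  (forall j, bounded_measurable (h j)) ->
  bounded_measurable (fun x => \sum_j h j x).
Proof.
move=> mh; elim: (index_enum I) => [|j r IH].
  have -> : (fun x => \sum_(j <- [::]) h j x) = fun=> 0.
    by apply/funext => x; rewrite big_nil.
  exact: bounded_measurable_cst.
have -> : (fun x => \sum_(j <- j :: r) h j x) =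
    fun x => h j x + \sum_(j <- r) h j x.
  by apply/funext => x; rewrite big_cons.
exact: bounded_measurableD.
Qed.

Lemma bounded_integrable (f : T -> R) (M : R) : measurable_fun setT f ->
  (forall x, `|f x| <= M) -> mu.-integrable setT (EFin \o f).
Proof.
move=> mf fM; apply: measurable_bounded_integrable => //.
  by rewrite -ge0_fin_numE //; exact: fin_num_measure.
exists M; split; first exact: num_real.
by move=> N MN x _ /=; exact: le_trans (fM x) (ltW MN).
Qed.

Lemma bounded_measurable_integrable h : bounded_measurable h ->
  mu.-integrable setT (EFin \o (@complex.Re R \o h)) /\
  mu.-integrable setT (EFin \o (@complex.Im R \o h)).
Proof.
by move=> [m1 m2 [M hM]]; split; apply: (@bounded_integrable _ M) => // x;
  case: (hM x).
Qed.

Lemma Rintegral_probability_cst (r : R) : \int[mu]_(x in [set: T]) r = r.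
Proof.
rewrite Rintegral_cst //.
exact: etrans (congr1 (fun z => r * fine z) (probability_setT mu)) (mulr1 r).
Qed.

Lemma cintegral_cst c : cintegral mu (fun=> c) = c.
Proof. by apply: complex_ext; exact: Rintegral_probability_cst. Qed.

Lemma cintegralD h g : bounded_measurable h -> bounded_measurable g ->
  cintegral mu (fun x => h x + g x) = cintegral mu h + cintegral mu g.
Proof.
move=> /bounded_measurable_integrable[h1 h2] /bounded_measurable_integrable[g1 g2].
apply: complex_ext => /=.
  by under eq_Rintegral do rewrite ReD; exact: RintegralD.
by under eq_Rintegral do rewrite ImD; exact: RintegralD.
Qed.

Lemma cintegralJ h : bounded_measurable h ->
  cintegral mu (fun x => (h x)^*) = (cintegral mu h)^*.
Proof.
move=> /bounded_measurable_integrable[h1 h2].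
apply: complex_ext; rewrite ?ReJ ?ImJ /=.
  by under eq_Rintegral do rewrite ReJ.
under eq_Rintegral do rewrite ImJ -mulN1r.
by rewrite RintegralZl // mulN1r.
Qed.

Lemma cintegralZ c h : bounded_measurable h ->
  cintegral mu (fun x => c * h x) = c * cintegral mu h.
Proof.
move=> /bounded_measurable_integrable[h1 h2].
have iZ r f : mu.-integrable setT (EFin \o f) ->
    mu.-integrable setT (EFin \o (fun x => r * f x)).
  by move=> fi; apply: (integrableZl _ r fi).
apply: complex_ext; rewrite ?ReM ?ImM /=.
  under eq_Rintegral do rewrite ReM.
  by rewrite RintegralB ?RintegralZl //; exact: iZ.
under eq_Rintegral do rewrite ImM.
by rewrite RintegralD ?RintegralZl //; exact: iZ.
Qed.

Lemma cintegral_sum (I : finType) (h : I -> T -> R[i]) :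
  (forall j, bounded_measurable (h j)) ->
  cintegral mu (fun x => \sum_j h j x) = \sum_j cintegral mu (h j).
Proof.
move=> mh; suff [] : bounded_measurable (fun x => \sum_j h j x) /\
  cintegral mu (fun x => \sum_j h j x) = \sum_j cintegral mu (h j) by [].
elim: (index_enum I) => [|j r [mr IH]].
  have -> : (fun x => \sum_(j <- [::]) h j x) = fun=> 0.
    by apply/funext => x; rewrite big_nil.
  by rewrite big_nil cintegral_cst; split=> //; exact: bounded_measurable_cst.
have -> : (fun x => \sum_(j <- j :: r) h j x) =
    fun x => h j x + \sum_(j <- r) h j x.
  by apply/funext => x; rewrite big_cons.
rewrite big_cons cintegralD // IH; split=> //; exact: bounded_measurableD.
Qed.

Lemma cintegral_ge0 h : (forall x, 0 <= h x) -> 0 <= cintegral mu h.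
Proof.
(* In the order of R[i], a nonnegative element has zero imaginary part. *)
move=> h0; rewrite lecE /=; have hx x : (complex.Im (h x) = 0) /\ 0 <= complex.Re (h x).
  by have := h0 x; rewrite lecE => /andP[/eqP].
under eq_Rintegral do rewrite (hx _).1.
rewrite Rintegral_probability_cst eqxx /=.
by apply: Rintegral_ge0 => x _; case: (hx x).
Qed.

Section Bessel.
Variables (I : finType) (e : I -> T -> R[i]) (h : T -> R[i]).
Hypothesis me : forall j, bounded_measurable (e j).
Hypothesis ortho : forall j l, cintegral mu (fun x => e j x * (e l x)^*) = (j == l)%:R.
Hypotheses (mh : bounded_measurable h) (h1 : unit_bounded h).

Let c j := cintegral mu (fun x => h x * (e j x)^*).

(** With p the orthogonal projection of h, both <h, p> and <p, p> equal the sum of the |c_j|^2, so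
    expanding the integral of |h - p|^2 gives the bound. *)
Lemma bessel_le1 : \sum_j `|c j| ^+ 2 <= 1.
Proof.
pose p x := \sum_j c j * e j x.
have mc a : bounded_measurable (fun=> a) := bounded_measurable_cst a.
have mp : bounded_measurable p.
  by apply: bounded_measurable_sum => j; exact: bounded_measurableM.
have mhe j : bounded_measurable (fun x => h x * (e j x)^*).
  exact/bounded_measurableM/bounded_measurableJ.
have hp : cintegral mu (fun x => h x * (p x)^*) = \sum_j `|c j| ^+ 2.
  have -> : (fun x => h x * (p x)^*) =
      fun x => \sum_j (c j)^* * (h x * (e j x)^*).
    apply/funext => x; rewrite rmorph_sum mulr_sumr; apply: eq_bigr => j _.
    by rewrite rmorphM /=; ring.
  rewrite cintegral_sum => [|j]; last exact: bounded_measurableM.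
  by apply: eq_bigr => j _; rewrite cintegralZ // normCK mulrC.
have pp : cintegral mu (fun x => p x * (p x)^*) = \sum_j `|c j| ^+ 2.
  have mee j l : bounded_measurable (fun x => e j x * (e l x)^*).
    exact/bounded_measurableM/bounded_measurableJ.
  have -> : (fun x => p x * (p x)^*) =
      fun x => \sum_j \sum_l (c j * (c l)^*) * (e j x * (e l x)^*).
    apply/funext => x; rewrite rmorph_sum mulr_suml; apply: eq_bigr => j _.
    rewrite mulr_sumr; apply: eq_bigr => l _.
    by rewrite rmorphM /=; ring.
  rewrite cintegral_sum => [|j]; last first.
    by apply: bounded_measurable_sum => l; exact: bounded_measurableM.
  apply: eq_bigr => j _; rewrite cintegral_sum => [|l]; last first.
    exact: bounded_measurableM.
  rewrite (bigD1 j) //= cintegralZ // ortho eqxx mulr1 -normCK big1 ?addr0 // => l lj.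
  by rewrite cintegralZ // ortho eq_sym (negbTE lj) mulr0.
(* Adding the nonnegative 1 - |h|^2 cancels the |h|^2 of the expansion and leaves the constant 1. *)
have : 0 <= cintegral mu (fun x => `|h x - p x| ^+ 2 + (1 - `|h x| ^+ 2)).
  apply: cintegral_ge0 => x; rewrite addr_ge0 ?exprn_ge0 // subr_ge0.
  by rewrite expr_le1.
have -> : (fun x => `|h x - p x| ^+ 2 + (1 - `|h x| ^+ 2)) =
    fun x => 1 + (- 1 * (h x * (p x)^*) + (- 1 * (h x * (p x)^*)^* + p x * (p x)^*)).
  by apply/funext => x; rewrite !normCK rmorphB rmorphM /= conjCK; ring.
have mhp : bounded_measurable (fun x => h x * (p x)^*).
  exact/bounded_measurableM/bounded_measurableJ.
have mpp : bounded_measurable (fun x => p x * (p x)^*).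
  exact/bounded_measurableM/bounded_measurableJ.
have mhpJ := bounded_measurableJ mhp.
have m1 := bounded_measurableM (mc (-1)) mhp.
have m2 := bounded_measurableM (mc (-1)) mhpJ.
have m3 := bounded_measurableD m2 mpp.
have m4 := bounded_measurableD m1 m3.
rewrite !cintegralD // cintegral_cst !cintegralZ // cintegralJ // hp pp.
have -> : (\sum_j `|c j| ^+ 2)^* = \sum_j `|c j| ^+ 2.
  by rewrite rmorph_sum; apply: eq_bigr => j _; rewrite rmorphXn /= conj_normC.
by rewrite !mulN1r addNr addr0 subr_ge0.
Qed.

End Bessel.
End ComplexIntegral.

(** * Haar measure and orthogonality of characters *)

Section Characters.
Variables (R : realType) (A : topologicalZmodType).
Variable mu : probability (borel (pointed_group A)) R.

Lemma continuous_borel_measurable (T : ptopologicalType) (f : T -> R) :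
  continuous f -> measurable_fun [set: borel T] (f : borel T -> R).
Proof.
move=> /continuousP cf; apply: (measurability _ (RGenOpens.measurableE R)).
move=> _ [_ [a [b ->] <-]]; rewrite setTI; apply: sub_sigma_algebra.
exact/cf/interval_open.
Qed.

Lemma translation_continuous (a : A) : continuous (fun x : A => a + x).
Proof.
move=> x; apply: (@continuous_comp _ _ _ (fun x => (a, x)) (fun p : A * A => p.1 + p.2)).
  by apply: cvg_pair => //=; exact: cvg_cst.
exact: add_continuous.
Qed.

Lemma translation_measurable (a : A) :
  measurable_fun [set: borel (pointed_group A)]
    ((fun x : A => a + x) : borel (pointed_group A) -> borel (pointed_group A)).
Proof.
have E : @measurable _ (borel (pointed_group A)) = <<s @open (pointed_group A) >> by [].
apply: (measurability _ E).
move=> _ [U oU <-]; rewrite setTI; apply: sub_sigma_algebra.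
by move/continuousP : (@translation_continuous a); exact.
Qed.

Hypothesis mu_haar : haar_probability mu.

(** Change of variables: the image of [mu] under translation by [a] is [mu] itself. *)
Lemma haar_Rintegral (f : A -> R) (a : A) :
  mu.-integrable [set: borel (pointed_group A)] (EFin \o f) ->
  \int[mu]_(x in [set: borel (pointed_group A)]) f (a + x) =
  \int[mu]_(x in [set: borel (pointed_group A)]) f x.
Proof.
move=> intf; rewrite /Rintegral; congr fine; apply/esym.
pose phi : borel (pointed_group A) -> borel (pointed_group A) := fun x : A => a + x.
have mphi : measurable_fun setT phi := translation_measurable a.
have muphi B : measurable B -> B `<=` setT -> mu B = pushforward mu phi B.
  by move=> mB _; rewrite -(mu_haar a mB).
rewrite (eq_measure_integral (pushforward mu phi)) //.
have mf : measurable_fun setT (EFin \o (f : borel (pointed_group A) -> R)) by exact: measurable_int intf.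
rewrite integral_pushforward //.
apply/integrableP; split; first by apply: measurableT_comp.
have /integrableP[_] := intf; apply: le_lt_trans.
rewrite [leRHS](eq_measure_integral (pushforward mu phi)) //.
rewrite ge0_integral_pushforward //.
by apply: measurableT_comp.
Qed.

Lemma haar_cintegral (h : A -> R[i]) (a : A) :
  bounded_measurable (h : borel (pointed_group A) -> R[i]) ->
  cintegral mu (fun x : borel (pointed_group A) => h (a + x : A)) =
  cintegral mu (h : borel (pointed_group A) -> R[i]).
Proof.
move=> mh; have [h1 h2] := bounded_measurable_integrable mu mh.
by apply: complex_ext => /=; apply: (@haar_Rintegral (_ \o h)).
Qed.

Lemma continuous_bounded_measurable (T : ptopologicalType) (h : T -> R[i]) :
  continuous (@complex.Re R \o h) -> continuous (@complex.Im R \o h) ->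
  unit_bounded h -> bounded_measurable (h : borel T -> R[i]).
Proof.
move=> /continuous_borel_measurable h1 /continuous_borel_measurable h2 hb.
split=> //; exists 1 => x; have := hb x; rewrite normc_def lecR => hx.
have {hx} : complex.Re (h x) ^+ 2 + complex.Im (h x) ^+ 2 <= 1.
  by rewrite -(@expr_le1 _ 2) ?sqrtr_ge0 // sqr_sqrtr ?addr_ge0 ?sqr_ge0 // in hx.
by move=> hx; split; rewrite -sqrtr_sqr -sqrtr1 ler_sqrt // (le_trans _ hx) //
  ?lerDl ?lerDr sqr_ge0.
Qed.

Lemma cmodE (z : R[i]) : (cmod z)%:C%C = `|z|.
Proof. by rewrite /cmod normc_def. Qed.

Lemma cmod_le (z : R[i]) (r : R) : (cmod z <= r) = (`|z| <= r%:C%C).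
Proof. by rewrite -lecR cmodE. Qed.

Lemma norm_character (chi : A -> R[i]) x : is_character chi -> `|chi x| = 1.
Proof. by move=> [_ c1 _ _]; rewrite -cmodE c1. Qed.

Lemma character_bounded_measurable (chi : A -> R[i]) : is_character chi ->
  bounded_measurable (chi : borel (pointed_group A) -> R[i]).
Proof.
move=> cchi; have [_ _ c1 c2] := cchi.
apply: (@continuous_bounded_measurable (pointed_group A)) => // x.
by rewrite norm_character.
Qed.

Lemma character_neq0 (chi : A -> R[i]) x : is_character chi -> chi x != 0.
Proof. by move=> cchi; rewrite -normr_eq0 norm_character ?oner_eq0. Qed.

(** If the characters differ at a, translating by a multiplies the integral by chi(a) times the
    conjugate of psi(a). This factor is not 1, so the integral vanishes. *)
Lemma character_orthogonal (chi psi : A -> R[i]) :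
  is_character chi -> is_character psi ->
  cintegral mu (fun x : borel (pointed_group A) => chi x * (psi x)^*) =
  (`[< chi = psi >])%:R.
Proof.
move=> cchi cpsi; have mh : bounded_measurable
    (fun x : borel (pointed_group A) => chi x * (psi x)^*).
  by apply: bounded_measurableM; [|apply: bounded_measurableJ];
    exact: character_bounded_measurable.
have [e|ne] := asboolP (chi = psi).
  rewrite e -(cintegral_cst mu 1) /=; congr cintegral; apply/funext => x.
  by rewrite -normCK norm_character // expr1n.
have [a na] : exists a, chi a != psi a.
  apply: contra_notP ne => /forallNP na; apply/funext => a.
  by apply/eqP; have := na a; move/negP; rewrite negbK.
have [Dchi _ _ _] := cchi; have [Dpsi _ _ _] := cpsi.
pose I := cintegral mu (fun x : borel (pointed_group A) => chi x * (psi x)^*).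
have : chi a * (psi a)^* * I = I.
  rewrite /I -[in RHS](haar_cintegral a mh) -cintegralZ //; congr cintegral.
  by apply/funext => x; rewrite Dchi Dpsi rmorphM; ring.
move/eqP; rewrite -subr_eq0 -[X in _ - X]mul1r -mulrBl mulf_eq0 => /orP[|/eqP //].
rewrite subr_eq0 => /eqP e; case/eqP: na.
apply: (mulIf (_ : (psi a)^* != 0)); first by rewrite conjC_eq0 character_neq0.
by rewrite e -normCK norm_character // expr1n.
Qed.

(** For fixed x, the values F_chi(x) are the Fourier coefficients of z -> F(x + z), and the
    characters are orthonormal. *)
Lemma fourier_part_bessel (X : Type) (act : X -> A -> X) (F : X -> R[i])
    (S : {fset A -> R[i]}) x :
  (forall chi, chi \in S -> is_character chi) ->
  bounded_measurable (fun z : borel (pointed_group A) => F (act x z)) ->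
  unit_bounded F ->
  \sum_(chi : S) `|fourier_part act mu F (val chi) x| ^+ 2 <= 1.
Proof.
move=> cS mF F1.
apply: (@bessel_le1 _ _ _ mu S (fun chi (z : borel (pointed_group A)) => val chi z)
  (fun z => F (act x z))) => //.
- by move=> chi; apply/character_bounded_measurable/cS/fsvalP.
- move=> chi psi; rewrite character_orthogonal; [|exact/cS/fsvalP..].
  congr (nat_of_bool _)%:R; apply/asboolP/eqP => [e|->//]; exact/val_inj.
Qed.

End Characters.

(** * Geodesic distance *)

Section Geodesic.
Variable R : realType.

Lemma normr_entry m n (B : 'M[R]_(m, n)) i j : `|B i j| <= `|B|.
Proof.
have -> : `|B| = \big[Num.max/0]_ij `|B ij.1 ij.2| by exact: mx_normrE.
exact: (le_bigmax _ (fun ij => `|B ij.1 ij.2|) (i, j)).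
Qed.

Lemma tensor_sq_le (M : topologicalType) n (G : @chart R M n -> 'rV[R]_n -> 'M[R]_n)
    c u v : tensor_sq G c u v <= (n%:R ^+ 2 * `|G c u|) * `|v| ^+ 2.
Proof.
rewrite /tensor_sq mxE; have vle j : `|v 0 j| <= `|v| := normr_entry v 0 j.
have -> : n%:R ^+ 2 * `|G c u| * `|v| ^+ 2 =
    \sum_(j < n) \sum_(i < n) `|v| * `|G c u| * `|v|.
  by rewrite !sumr_const !card_ord -mulrnA -[RHS]mulr_natl natrM; ring.
apply: ler_sum => j _; rewrite !mxE mulr_suml; apply: ler_sum => i _.
rewrite (le_trans (ler_norm _)) // !normrM !ler_pM ?mulr_ge0 //.
exact: normr_entry.
Qed.

(** Every simple function below f is also below g, so the inequality follows directly from the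
    definition of the integral as a supremum. *)
Lemma ge0_integral_mono d (T : measurableType d) (mu : {measure set T -> \bar R})
    (A : set T) (f g : T -> \bar R) : (forall x, A x -> 0 <= f x <= g x)%E ->
  (\int[mu]_(x in A) f x <= \int[mu]_(x in A) g x)%E.
Proof.
move=> fg; rewrite !ge0_integralE; last 2 first.
- by move=> x /fg /andP[]; exact: le_trans.
- by move=> x /fg /andP[].
apply: ereal_sup_le => _ [h hf <-]; exists h => // x; apply: le_trans (hf x) _; rewrite /patch.
by case: ifPn => // /set_mem /fg /andP[].
Qed.

Lemma unit_interval_Rintegral_le (g : R -> R) (B : R) :
  (forall t, 0 <= t <= 1 -> 0 <= g t <= B) ->
  \int[lebesgue_measure]_(t in `[0, 1]) g t <= B.
Proof.
move=> gB; rewrite /Rintegral.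
have muI : (@lebesgue_measure R `[0%R, 1%R]%classic = 1)%E.
  by rewrite lebesgue_measure_itv /= lte01 oppr0 adde0.
have le1 : (\int[lebesgue_measure]_(t in `[0%R, 1%R]) (g t)%:E <= B%:E)%E.
  apply: (@le_trans _ _ (\int[@lebesgue_measure R]_(t in `[0%R, 1%R]) (cst B%:E t))%E).
    apply: ge0_integral_mono => t /=; rewrite in_itv /= => /gB /andP[g0 gt].
    by rewrite !lee_fin g0.
  by rewrite integral_cst // [X in (_ * X)%E]muI mule1.
have ge0 : (0 <= \int[lebesgue_measure]_(t in `[0%R, 1%R]) (g t)%:E)%E.
  apply: integral_ge0 => t /=; rewrite in_itv /= => /gB /andP[g0 _].
  by rewrite lee_fin.
rewrite -lee_fin fineK // ge0_fin_numE //.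
by rewrite (le_lt_trans le1) // ltry.
Qed.

Lemma segment_derive (V : normedModType R) (u w : V) (t : R) :
  is_derive t (1 : R) (fun t : R => u + t *: w) w.
Proof.
apply: DeriveDef.
  apply: derivableD; first exact: derivable_cst.
  by apply: diff_derivable; apply: differentiableZl.
rewrite deriveD; last 2 first.
- exact: derivable_cst.
- by apply: diff_derivable; apply: differentiableZl.
rewrite derive_cst add0r deriveE; last exact: differentiableZl.
by rewrite diffZl //= diff_val scale1r.
Qed.

Section Chart.
Variables (M : topologicalType) (n : nat) (At : set (@chart R M n)).
Variable G : @chart R M n -> 'rV[R]_n -> 'M[R]_n.

Lemma path_length_ge0 x y l : path_length At G x y l -> 0 <= l.
Proof.
elim=> // c s z l' _ _ _ _ _ l0; rewrite addr_ge0 //.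
by apply: Rintegral_ge0 => t _; exact: sqrtr_ge0.
Qed.

Hypotheses (smAt : smooth_atlas At) (riem : riemannian At G).

(** Near [y0] the Gram matrix is bounded by [B], so a straight segment in the chart has length at
    most [K] times its Euclidean displacement [w]. *)
Lemma geodesic_dist_near (y0 : M) (eps : R) : 0 < eps ->
  \forall y \near y0, geodesic_dist At G y0 y < eps.
Proof.
move=> eps0; have [chA covA _] := smAt; have [smG _ _] := riem.
have [c Atc domy0] := covA y0.
have [odom oimg invK cfwd cinv] := chA c Atc.
pose u0 := fwd c y0.
have img0 : img c u0 by exists y0.
have cG : {for u0, continuous (G c)} by exact: (smG c Atc 0%N).
pose B := `|G c u0| + 1.
have nearB : \forall u \near u0, `|G c u| < B.
  by apply: (cvgr_lt _ (cvg_norm cG)); rewrite ltrDl.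
have : \forall u \near u0, img c u /\ `|G c u| < B.
  by apply: filterI => //; exact: open_nbhs_nbhs.
move=> /nbhs_ballP[r /= r0 ballr].
(* The root bounds the speed of the segment relative to |w|; the + 1 makes [K] positive, to allow
   division by it. *)
pose K := Num.sqrt (n%:R ^+ 2 * B) + 1.
have K0 : 0 < K by rewrite ltr_wpDl ?sqrtr_ge0.
have fwdc : {for y0, continuous (fwd c)}.
  by move: cfwd; rewrite continuous_open_subspace //; apply; rewrite inE.
near=> y.
have domy : dom c y by near: y; exact: open_nbhs_nbhs.
pose w := fwd c y - u0.
have wr : `|w| < r.
  rewrite /w distrC; near: y; apply: (cvgr_dist_lt (fwd c) (fwd c y0) fwdc) => //.
have weps : `|w| < eps / K.
  rewrite /w distrC; near: y; apply: (cvgr_dist_lt (fwd c) (fwd c y0) fwdc) => //.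
  by rewrite divr_gt0.
pose s t : 'rV[R]_n := u0 + t *: w.
have sball t : 0 <= t <= 1 -> img c (s t) /\ `|G c (s t)| < B.
  move=> /andP[t0 t1]; apply: ballr.
  rewrite -ball_normE /ball_ /= /s opprD addrA subrr add0r normrN normrZ.
  by rewrite (le_lt_trans _ wr) // ger0_norm // ler_piMl.
have s0 : Defs.inv c (s 0) = y0.
  rewrite /s scale0r addr0 -/u0. exact: invK.
have s1 : Defs.inv c (s 1) = y by rewrite /s scale1r /w addrC subrK; exact: invK.
have ds t := segment_derive u0 w t.
have dvs t : derivable s t 1 by have [] := ds t.
have sE : derive1 s = cst w.
  by apply/funext => t; rewrite derive1E; exact: derive_val.
have cs : continuous s.
  move=> t; apply/differentiable_continuous/derivable1_diffP.
  exact: dvs.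
(* The image of the segment is connected, so y lies in the component of [y0] and the distance is the
   infimum of path lengths. *)
rewrite /geodesic_dist asboolT; last first.
  have cis : {within `[0%R, 1%R], continuous (Defs.inv c \o s)}.
    apply: continuous_in_subspaceT => t; rewrite inE /= in_itv /= => t01.
    apply: continuous_comp; first exact: cs.
    move: cinv; rewrite continuous_open_subspace //; apply; rewrite inE.
    exact: (sball t t01).1.
  apply: (@connected_component_max _ _ ((Defs.inv c \o s) @` `[0%R, 1%R])) => //.
  - by exists 0; rewrite //= in_itv /= lexx ler01.
  - apply: connected_continuous_connected => //; exact: segment_connected.
  - by exists 1; rewrite //= in_itv /= lexx ler01.
set L := \int[lebesgue_measure]_(t in `[0%R, 1%R])
  Num.sqrt (tensor_sq G c (s t) (derive1 s t)).
have dsc : continuous (derive1 s) by rewrite sE; exact: cst_continuous.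
have simg t : 0 <= t <= 1 -> img c (s t) by move=> /sball[].
have tail : path_length At G (Defs.inv c (s 1)) y 0 by rewrite s1; exact: PathNil.
have pl := PathCons Atc dvs dsc simg tail.
rewrite s0 -/L in pl.
have LK : L <= K * `|w|.
  apply: unit_interval_Rintegral_le => t /sball[_ GB]; rewrite sqrtr_ge0 /= sE /=.
  apply: (@le_trans _ _ (Num.sqrt (n%:R ^+ 2 * B * `|w| ^+ 2))).
    apply: ler_wsqrtr; apply: le_trans (tensor_sq_le _ _ _ _) _.
    by rewrite ler_wpM2r ?exprn_ge0 // ler_wpM2l ?exprn_ge0 ?ler0n // ltW.
  rewrite sqrtrM ?mulr_ge0 ?exprn_ge0 ?ler0n //; last by rewrite /B addr_ge0.
  by rewrite sqrtr_sqr normr_id ler_wpM2r // lerDl.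
apply: (@le_lt_trans _ _ (L + 0)).
  apply: ge_inf => //; exists 0 => l; exact: path_length_ge0.
rewrite addr0 (le_lt_trans LK) //.
by rewrite mulrC -ltr_pdivlMr.
Unshelve. all: by end_near.
Qed.

Lemma lipschitz_continuous (L : R) (F : M -> R[i]) : 0 <= L ->
  lipschitz_for (geodesic_dist At G) L F ->
  continuous (@complex.Re R \o F) /\ continuous (@complex.Im R \o F).
Proof.
move=> L0 lip.
have key (p : R[i] -> R) : (forall z, `|p z| <= cmod z) ->
    (forall x y, p (x - y) = p x - p y) -> continuous (p \o F).
  move=> pz pB y0; apply/cvgrPdist_lt => e e0.
  near=> y; rewrite /= -pB.
  apply: le_lt_trans (pz _) _; apply: le_lt_trans (lip y0 y) _.
  (* Replacing L by L + 1 covers L = 0 in the division below. *)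
  apply: (@le_lt_trans _ _ ((L + 1) * geodesic_dist At G y0 y)).
    rewrite ler_wpM2r ?lerDl //.
    rewrite /geodesic_dist; case: ifP => // _.
    (* If no path joins the two points, the infimum of the empty set is 0 by convention. *)
    have [->|ne] := eqVneq [set l | path_length At G y0 y l] set0; first by rewrite inf0.
    by apply: lb_le_inf; [exact/set0P|move=> l; exact: path_length_ge0].
  rewrite mulrC -ltr_pdivlMr ?ltr_wpDl //; near: y.
  by apply: geodesic_dist_near; rewrite divr_gt0 // ltr_wpDl.
have sq (z : R[i]) : cmod z = Num.sqrt (complex.Re z ^+ 2 + complex.Im z ^+ 2).
  by rewrite /cmod normc_def.
split; apply: key => [z|[? ?] [? ?]] //; rewrite sq -sqrtr_sqr ler_wsqrtr //.
  by rewrite lerDl sqr_ge0.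
by rewrite lerDr sqr_ge0.
Unshelve. all: by end_near.
Qed.

End Chart.
End Geodesic.

(** * Regularity decompositions *)

Lemma Re_le_norm (R : realType) (z : R[i]) (r : R) :
  `|z| <= r%:C%C -> `|complex.Re z| <= r.
Proof. by move=> zr; rewrite -lecR (le_trans (normc_ge_Re z)). Qed.

Lemma continuous_along_orbit (T A U : topologicalType) (act : T -> A -> T)
    (g : T -> U) x :
  continuous (fun p : T * A => act p.1 p.2) -> continuous g ->
  continuous (fun z => g (act x z)).
Proof.
move=> cact cg z; apply: (@continuous_comp _ _ _ (fun z => act x z) g); last exact: cg.
apply: (@continuous_comp _ _ _ (fun z => (x, z)) (fun p : T * A => act p.1 p.2)).
  by apply: cvg_pair => //=; exact: cvg_cst.
exact: cact.
Qed.

Section Regularity.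
Variables (R : realType) (Ch : choices R) (k : nat) (eta : R).
Variables (D : R -> nat -> R) (Z : finZmodType) (f : Z -> R[i]) (m : nat).
Hypothesis k0 : (0 < k)%N.
Variable dec : regularity_decomposition Ch k eta D f m.

Let G (chi : rd_S dec) : Z -> R[i] := rd_g dec (val chi).

(** The g_chi(x) are Fourier coefficients of F along the orbit through phi(x), where F is measurable
    because the Lipschitz condition makes it continuous. *)
Lemma rd_g_bessel x : \sum_chi `|G chi x| ^+ 2 <= 1.
Proof.
have F1 : unit_bounded (rd_F (r := dec)).
  by move=> y; rewrite -[leRHS]/(1%:C%C) -cmod_le; exact: rd_F_bounded.
have step : is_step (cs_cubes (Y Ch (rd_i dec))) k := @rd_step _ _ _ _ _ _ _ _ dec.
have [_ [_ _ _ cact] _ _] := Zact_structure k0 step.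
have [smA _] := Yatlas_nil Ch (rd_i dec).
have [cRe cIm] := lipschitz_continuous smA
  (Ytensor_riemannian Ch (rd_i dec)) (ler0n _ m) (rd_F_lipschitz (r := dec)).
apply: (fourier_part_bessel (Zhaar_haar k0 step) (rd_S_character (r := dec))) => //.
apply: (@continuous_bounded_measurable R (pointed_group (Zk Ch (rd_i dec) k))) => //.
  exact: (continuous_along_orbit (x := rd_phi dec x) cact cRe).
exact: (continuous_along_orbit (x := rd_phi dec x) cact cIm).
Qed.

Lemma rd_g_unit_bounded chi : unit_bounded (G chi).
Proof.
move=> x; rewrite -(@expr_le1 _ 2) //; apply: le_trans (rd_g_bessel x).
by rewrite (bigD1 chi) //= lerDl sumr_ge0 // => d _; rewrite exprn_ge0.
Qed.

Lemma rd_g_gowers_sumE :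
  \sum_(chi <- rd_S dec) gowers_norm k.+1 (rd_g dec chi) ^+ (2 ^ k.+1) =
  complex.Re (\sum_chi gowers_avg (fun _ : dcube k.+1 => G chi)).
Proof.
rewrite big_seq_fsetE /= (big_morph _ (@ReD R) (erefl _)).
by apply: eq_bigr => chi _; rewrite gowers_normX.
Qed.

(** Both quantities lie in [0, 1]. This settles the case of large eta. *)
Lemma rd_error_le1 : bounded1 f ->
  `|gowers_norm k.+1 f ^+ (2 ^ k.+1) -
    \sum_(chi <- rd_S dec) gowers_norm k.+1 (rd_g dec chi) ^+ (2 ^ k.+1)| <= 1.
Proof.
move=> hf; rewrite rd_g_gowers_sumE gowers_normX //.
have f1 : unit_bounded f by move=> x; rewrite -[leRHS]/(1%:C%C) -cmod_le; exact: hf.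
have unitRe (z : R[i]) : 0 <= z -> `|z| <= 1 -> 0 <= complex.Re z <= 1.
  move=> z0; rewrite -[leRHS]/(1%:C%C) => /Re_le_norm.
  by move: z0; rewrite lecE /= => /andP[_ z0]; rewrite z0 ger0_norm.
have /andP[a0 a1] := unitRe _ (gowers_avg_const_ge0 f (ltn0Sn k))
  (norm_gowers_avg_le1 (fun=> f1)).
have /andP[b0 b1] := unitRe _
  (sumr_ge0 _ (fun chi _ => gowers_avg_const_ge0 (G chi) (ltn0Sn k)))
  (sum_gowers_avg_le1 k rd_g_bessel).
by rewrite ler_norml; apply/andP; split; lra.
Qed.

(** The abstract estimate is applied with [delta] the 2^k-th root of D(eta, m), and carried back
    from R[i] to R by taking real parts. *)
Lemma rd_error_small_eta : 0 < eta <= 1 -> 0 < D eta m -> bounded1 f ->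
  `|gowers_norm k.+1 f ^+ (2 ^ k.+1) -
    \sum_(chi <- rd_S dec) gowers_norm k.+1 (rd_g dec chi) ^+ (2 ^ k.+1)| <=
  (2 ^ k.+1)%N%:R * (eta + D eta m) + (2 ^+ (2 ^ k.+1) - 1) * eta +
  (#|` rd_S dec| ^ (2 ^ k.+1) - 1)%N%:R * D eta m `^ (1 / (2 ^ k)%N%:R).
Proof.
move=> /andP[eta0 eta1] D0 hf; rewrite rd_g_gowers_sumE gowers_normX //.
set delta := D eta m `^ _.
have ReB (x y : R[i]) : complex.Re x - complex.Re y = complex.Re (x - y).
  by case: x y => [? ?] [].
rewrite ReB; apply: Re_le_norm.
have one : 1%:C%C = 1 :> R[i] by [].
have bnd (h : Z -> R[i]) : (forall x, cmod (h x) <= 1) -> unit_bounded h.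
  by move=> h1 x; rewrite -one -cmod_le.
have le_sup (h : Z -> R[i]) r : norm_sup h <= r -> forall x, cmod (h x) <= r.
  by move=> hr x; apply: le_trans hr; exact: (le_bigmax _ (fun x => cmod (h x)) x).
have /and3P[fr_gowers _ _] : [&& gowers_norm k.+1 (rd_fr dec) <= D eta m,
    cmod (inner (rd_fr dec) (rd_fs dec)) <= D eta m &
    cmod (inner (rd_fr dec) (rd_fe dec)) <= D eta m].
  by have := rd_fr_small dec; rewrite !ge_max.
have fE : f = rd_fs dec \+ (rd_fe dec \+ rd_fr dec).
  by apply/funext => x; rewrite (rd_f_eq dec) /= addrA.
have dE : delta ^+ (2 ^ k) = D eta m.
  by rewrite /delta -powR_mulrn ?powR_ge0 // -powRrM div1r mulVf ?powRr1 ?(ltW D0).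
have := @gowers_avg_decomposition R Z k (rd_S dec) G (rd_fs dec) (rd_fe dec)
  (rd_fr dec) (rd_ge dec) eta%:C%C (D eta m)%:C%C delta%:C%C.
rewrite -fE.
have cardS : #|{: rd_S dec}| = #|` rd_S dec| by rewrite cardfE.
rewrite cardS => /(_ _ _ _ _ _ _ _ _ _ _ _ _)/le_trans; apply.
- by rewrite ler0c ltW.
- by rewrite ler0c powR_ge0.
- by rewrite ler0c -one lecR ltW.
- exact: bnd.
- by apply: bnd => x; rewrite (rd_fs_eq dec); exact: rd_F_bounded.
- exact/bnd/le_sup/rd_fr_bounded.
- have := rd_fe_small dec; rewrite /norm1 -lecR rmorphM fmorphV rmorph_nat /=.
  rewrite rmorph_sum; congr (_ / _ <= _); apply: eq_bigr => x _; exact: cmodE.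
- have P0 := gowers_avg_const_ge0 (rd_fr dec) (ltn0Sn k).
  rewrite ger0_norm //.
  have <- : (complex.Re (gowers_avg (fun _ : dcube k.+1 => rd_fr dec)))%:C%C =
      gowers_avg (fun _ : dcube k.+1 => rd_fr dec).
    by rewrite RRe_real // ger0_real.
  rewrite -rmorphXn lecR -gowers_normX //.
  by rewrite lerXn2r // nnegrE ?powR_ge0 // ltW.
- apply/funext => x; rewrite (rd_fs_sum dec) big_seq_fsetE.
  by [].
- by move=> x; rewrite -cmod_le; apply: le_sup; exact: rd_ge_small.
- exact: rd_g_unit_bounded.
- move=> chi psi ne; have i0 := gowers_inner_ge0 (G chi) (G psi) k0.
  rewrite ger0_norm // -rmorphXn dE -[leLHS]RRe_real ?ger0_real // lecR.
  have := rd_quasi_orth (r := dec) (fsvalP chi) (fsvalP psi) ne.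
  by rewrite ge_max => /andP[].
by rewrite !(rmorph_nat, rmorphB, rmorphXn, rmorphM, rmorphD, rmorph1).
Qed.

End Regularity.

Theorem theorem5p6 (R : realType) (Ch : choices R) (k : nat) (hk : (0 < k)%N)
    (N : R -> (R -> nat -> R) -> nat) (hN : regularity_bound Ch k N)
    (D : R -> nat -> R) (hD : forall (e : R) (m : nat), 0 < e -> 0 < D e m)
    (eta : R) (heta : 0 < eta)
    (Z : finZmodType) (f : Z -> R[i]) (hf : bounded1 f)
    (m : nat) (hm : (m <= N eta D)%N)
    (dec : regularity_decomposition Ch k eta D f m) :
  exists2 E : R,
    gowers_norm k.+1 f ^+ (2 ^ k.+1) =
      \sum_(chi <- rd_S dec) gowers_norm k.+1 (rd_g dec chi) ^+ (2 ^ k.+1) + E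
    & `|E| <=
      2 ^+ (2 ^ k.+1) *
        (4 * eta `^ (k.+2%:R / (2 ^ k.+1)%N%:R) + D eta m)
      + (#|` rd_S dec| ^ (2 ^ k.+1) - 1)%N%:R * D eta m `^ (1 / (2 ^ k)%N%:R).
Proof.
have D0 := hD eta m heta.
have d1 : (1 : R) <= 2 ^+ (2 ^ k.+1) by rewrite exprn_ege1 // ler1n.
set S := \sum_(chi <- rd_S dec) _.
exists (gowers_norm k.+1 f ^+ (2 ^ k.+1) - S); first by rewrite addrC subrK.
have delta0 : 0 <= (#|` rd_S dec| ^ (2 ^ k.+1) - 1)%N%:R
    * D eta m `^ (1 / (2 ^ k)%N%:R) by rewrite mulr_ge0 ?powR_ge0.
set alpha := _ / _.
(* The upper bound amounts to k + 2 <= 2^(k+1). *)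
have alpha01 : 0 <= alpha <= 1.
  rewrite divr_ge0 // ler_pdivrMr ?ltr0n ?expn_gt0 // mul1r ler_nat.
  exact: ltn_expl.
have /andP[alpha0 alpha1] := alpha01.
(* For eta >= 1, both factors of the first product on the right are at least 1. *)
have [eta1|eta1] := leP 1 eta.
  apply: le_trans (rd_error_le1 hk dec hf) _.
  apply: ler_wpDr => //; have e1 : 1 <= eta `^ alpha.
    by rewrite -(powRr0 eta) ler_powR.
  rewrite -[leLHS]mulr1 ler_pM //; lra.
have etale : eta <= eta `^ alpha.
  by rewrite -{1}(powRr1 (ltW heta)) ger_powR ?heta ?(ltW eta1).
apply: le_trans (rd_error_small_eta hk dec _ D0 hf) _; first by rewrite heta ltW.
rewrite lerD2r.
(* With d <= q, the remaining terms d (eta + D) + (q - 1) eta are at most q (2 eta + D), and eta <=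
   eta^alpha concludes. *)
have dle : (2 ^ k.+1)%N%:R <= 2 ^+ (2 ^ k.+1) :> R.
  by rewrite -natrX ler_nat ltnW // ltn_expl.
set d := (2 ^ k.+1)%N%:R in dle *; set q := 2 ^+ _ in dle d1 *.
nra.
Qed.
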